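(* Let $q,s_1,s_2,t_1,t_2$ be positive integers with $t_1^{s_1}\equiv1\pmod q$ and $t_2^{s_2}\equiv1\pmod q$, and let $$G=\langle x,y,z\mid x^{s_1}=y^{s_2}=z^q=1,\ xy=yx,\ zx=xz^{t_1},\ zy=yz^{t_2}\rangle.$$ For $n\ge0$, $m\ge0$ let $A_{n,m}$ be the free left $\mathbb{Z}[G]$-module on $n+1$ generators $a_{n,m,i}$, $0\le i\le n$, and define $\mathbb{Z}[G]$-linear maps $d_0,d_1,d_2$ by $$\begin{aligned} d_0a_{n,2m+1,i}&=(z-1)a_{n,2m,i},\\ d_0a_{n,2m,i}&=N_z\,a_{n,2m-1,i},\\ d_1a_{2n+1,2m,2i}&=(yL_{t_2,1}^m-1)a_{2n,2m,2i}+\sum_{j=0}^{s_1-1}x^jL_{t_1,j}^m\,a_{2n,2m,2i-1},\\ d_1a_{2n+1,2m,2i+1}&=-\sum_{j=0}^{s_2-1}y^jL_{t_2,j}^m\,a_{2n,2m,2i+1}+(xL_{t_1,1}^m-1)a_{2n,2m,2i},\\ d_1a_{2n+1,2m-1,2i}&=-(yL_{t_2,1}^m-1)a_{2n,2m-1,2i}-\sum_{j=0}^{s_1-1}x^jL_{t_1,j}^m\,a_{2n,2m-1,2i-1},\\ d_1a_{2n+1,2m-1,2i+1}&=\sum_{j=0}^{s_2-1}y^jL_{t_2,j}^m\,a_{2n,2m-1,2i+1}-(xL_{t_1,1}^m-1)a_{2n,2m-1,2i},\\ d_1a_{2n,2m,2i}&=\sum_{j=0}^{s_2-1}y^jL_{t_2,j}^m\,a_{2n-1,2m,2i}+\sum_{j=0}^{s_1-1}x^jL_{t_1,j}^m\,a_{2n-1,2m,2i-1},\\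 d_1a_{2n,2m,2i+1}&=-(yL_{t_2,1}^m-1)a_{2n-1,2m,2i+1}+(xL_{t_1,1}^m-1)a_{2n-1,2m,2i},\\ d_1a_{2n,2m-1,2i}&=-\sum_{j=0}^{s_2-1}y^jL_{t_2,j}^m\,a_{2n-1,2m-1,2i}-\sum_{j=0}^{s_1-1}x^jL_{t_1,j}^m\,a_{2n-1,2m-1,2i-1},\\ d_1a_{2n,2m-1,2i+1}&=(yL_{t_2,1}^m-1)a_{2n-1,2m-1,2i+1}-(xL_{t_1,1}^m-1)a_{2n-1,2m-1,2i},\\ d_2a_{n,2m,i}&=0,\\ d_2a_{n,2m-1,i}&=-\tfrac1q(t_2^{ms_2}-1)a_{n-2,2m,i}-\tfrac1q(t_1^{ms_1}-1)a_{n-2,2m,i-2}, \end{aligned}$$ where $L_{f,j}=\sum_{i=0}^{f^j-1}z^i$ and $N_z=\sum_{i=0}^{q-1}z^i$. Let $d=d_0+d_1+d_2$ and let $A=\bigoplus_{n,m}A_{n,m}$, graded by $\deg A_{n,m}=n+m$. Then $(A,d)$ is acyclic.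
   Context: Symbols $a_{n,m,i}$ with $n<0$, $m<0$, $i<0$ or $i>n$ are interpreted as $0$ (in particular $d_0a_{n,0,i}=0$). In formulas involving the index $2m-1$, $m\ge1$. The group $G$ is the split extension $1\to\mathbb{Z}_q\to G\to\mathbb{Z}_{s_1}\oplus\mathbb{Z}_{s_2}\to1$, with $\mathbb{Z}_q$ generated by $z$ and the complement by $x,y$. ''Acyclic'' means that $d^2=0$ and the homology of $(A,d)$ vanishes in positive degrees, i.e. $(A,d)$ is a free resolution of the trivial $\mathbb{Z}[G]$-module $\mathbb{Z}$. *)

(* Defs.v *)
From HB Require Import structures.
From mathcomp Require Import all_boot all_order all_algebra all_fingroup.
From mathcomp Require Import finmap.
From mathcomp Require Export monalg.

Set Implicit Arguments.
Unset Strict Implicit.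
Unset Printing Implicit Defensive.

Import GRing.Theory.

Local Open Scope fset.
Local Open Scope ring_scope.

(* The ring structure that monalg puts on {malg int[K]} needs a monoid K with
   no nontrivial units, so it does not apply to a group: only the additive
   structure is reused and the convolution product is defined here. *)
Definition group_ring (G : groupType) : Type := {malg int[G]}.

Notation "'Z[ G ]" := (group_ring G)
  (at level 0, G at level 200, format "''Z[' G ]") : type_scope.

HB.instance Definition _ (G : groupType) := GRing.Zmodule.on 'Z[G].

Section GroupRing.
Variable G : groupType.
Implicit Types (u v w : {malg int[G]}) (g h : G).

Definition gr_one : {malg int[G]} := mkmalgU 1%g 1.

Definition gr_mul u v : {malg int[G]} :=
  \sum_(g <- msupp u) \sum_(h <- msupp v) mkmalgU (g * h)%g (u@_g * v@_h).

Lemma gr_mulEw (D E : {fset G}) u v :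
  msupp u `<=` D -> msupp v `<=` E ->
  gr_mul u v
    = \sum_(g <- D) \sum_(h <- E) mkmalgU (g * h)%g (u@_g * v@_h).
Proof.
move=> leD leE; rewrite /gr_mul (big_fset_incl _ leD) /=.
  apply/eq_bigr=> g _; apply/big_fset_incl => // h _ /mcoeff_outdom ->.
  by rewrite mulr0 monalgU0.
move=> g _ /mcoeff_outdom ug.
by rewrite big1 => // h _; rewrite ug mul0r monalgU0.
Qed.

Lemma gr_mul0g : left_zero 0 gr_mul.
Proof. by move=> u; rewrite /gr_mul msupp0 big_seq_fset0. Qed.

Lemma gr_mulg0 : right_zero 0 gr_mul.
Proof.
by move=> u; rewrite /gr_mul msupp0 big1 // => g _; rewrite big_seq_fset0.
Qed.

Lemma gr_mulUU (a b : int) g h :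
  gr_mul (mkmalgU g a) (mkmalgU h b) = mkmalgU (g * h)%g (a * b).
Proof. by rewrite (gr_mulEw msuppU_le msuppU_le) !big_seq_fset1 !mcoeffUU. Qed.

Lemma gr_mulDl : left_distributive gr_mul +%R.
Proof.
move=> u v w.
rewrite (gr_mulEw (msuppD_le u v) (fsubset_refl _)).
rewrite (gr_mulEw (fsubsetUl (msupp u) (msupp v)) (fsubset_refl (msupp w))).
rewrite (gr_mulEw (fsubsetUr (msupp u) (msupp v)) (fsubset_refl (msupp w))).
rewrite -big_split /=; apply/eq_bigr=> g _.
rewrite -big_split /=; apply/eq_bigr=> h _.
by rewrite mcoeffD mulrDl monalgUD.
Qed.

Lemma gr_mulDr : right_distributive gr_mul +%R.
Proof.
move=> w u v.
rewrite (gr_mulEw (fsubset_refl _) (msuppD_le u v)).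
rewrite (gr_mulEw (fsubset_refl (msupp w)) (fsubsetUl (msupp u) (msupp v))).
rewrite (gr_mulEw (fsubset_refl (msupp w)) (fsubsetUr (msupp u) (msupp v))).
rewrite -big_split /=; apply/eq_bigr=> g _.
rewrite -big_split /=; apply/eq_bigr=> h _.
by rewrite mcoeffD mulrDr monalgUD.
Qed.

Lemma gr_mul_suml I (r : seq I) (F : I -> {malg int[G]}) v :
  gr_mul (\sum_(i <- r) F i) v = \sum_(i <- r) gr_mul (F i) v.
Proof.
exact: (big_morph (gr_mul^~ v) (fun _ _ => gr_mulDl _ _ _) (gr_mul0g _)).
Qed.

Lemma gr_mul_sumr I (r : seq I) (F : I -> {malg int[G]}) v :
  gr_mul v (\sum_(i <- r) F i) = \sum_(i <- r) gr_mul v (F i).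
Proof.
exact: (big_morph (gr_mul v) (fun _ _ => gr_mulDr _ _ _) (gr_mulg0 _)).
Qed.

Lemma gr_mul1g : left_id gr_one gr_mul.
Proof.
move=> u; rewrite {1}[u]monalgE gr_mul_sumr [RHS]monalgE.
by apply/eq_bigr => g _; rewrite gr_mulUU mul1r mul1g.
Qed.

Lemma gr_mulg1 : right_id gr_one gr_mul.
Proof.
move=> u; rewrite {1}[u]monalgE gr_mul_suml [RHS]monalgE.
by apply/eq_bigr => g _; rewrite gr_mulUU mulr1 mulg1.
Qed.

Lemma gr_mulA : associative gr_mul.
Proof.
move=> u v w; rewrite [u]monalgE !gr_mul_suml; apply/eq_bigr=> g _.
rewrite [v]monalgE gr_mul_suml !gr_mul_sumr gr_mul_suml.
apply/eq_bigr=> h _; rewrite [w]monalgE !gr_mul_sumr.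
by apply/eq_bigr=> k _; rewrite !gr_mulUU mulrA mulgA.
Qed.

Lemma gr_one_neq0 : gr_one != 0.
Proof. by rewrite monalgU_eq0 oner_eq0. Qed.

HB.instance Definition _ := GRing.Zmodule_isNzRing.Build 'Z[G]
  gr_mulA gr_mul1g gr_mulg1 gr_mulDl gr_mulDr gr_one_neq0.

Definition gr_elt (g : G) : 'Z[G] := mkmalgU g 1.

End GroupRing.

Section LinearExtension.
Variables (K : choiceType) (R : nzRingType) (V : lmodType R) (f : K -> V).

Definition linext (c : {malg R[K]}) : V := \sum_(k <- msupp c) c@_k *: f k.

Lemma linextEw (D : {fset K}) c :
  msupp c `<=` D -> linext c = \sum_(k <- D) c@_k *: f k.
Proof.
move=> leD; rewrite /linext (big_fset_incl _ leD) // => k _ /mcoeff_outdom ->.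
by rewrite scale0r.
Qed.

Lemma linext_is_linear : linear linext.
Proof.
move=> r c1 c2; pose D := msupp c1 `|` msupp c2.
rewrite (@linextEw D c1) ?fsubsetUl // (@linextEw D c2) ?fsubsetUr //.
rewrite (@linextEw D); last first.
  apply: fsubset_trans (msuppD_le _ _) _.
  by apply: fsetSU; apply: msuppZ_le.
rewrite scaler_sumr -big_split /=; apply/eq_bigr => k _.
by rewrite mcoeffD mcoeffZ scalerDl scalerA.
Qed.

HB.instance Definition _ :=
  GRing.isLinear.Build R {malg R[K]} V *:%R linext linext_is_linear.

Lemma linextU k : linext (mkmalgU k 1) = f k.
Proof.
by rewrite (@linextEw [fset k]) ?msuppU_le // big_seq_fset1 mcoeffUU scale1r.
Qed.

End LinearExtension.

Section Presentation.
Variables (q s1 s2 t1 t2 : nat).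

Definition relations (H : groupType) (x y z : H) : Prop :=
  [/\ (x ^+ s1 = 1)%g, (y ^+ s2 = 1)%g & (z ^+ q = 1)%g] /\
  [/\ (x * y = y * x)%g, (z * x = x * z ^+ t1)%g & (z * y = y * z ^+ t2)%g].

Definition generated_by (G : groupType) (x y z : G) : Prop :=
  forall P : G -> Prop, P x -> P y -> P z -> P 1%g ->
    (forall g h, P g -> P h -> P (g * h)%g) ->
    (forall g, P g -> P (g^-1)%g) ->
  forall g, P g.

(* G is the group presented by the generators x, y, z and the relations
   above. *)
Definition presented (G : groupType) (x y z : G) : Prop :=
  [/\ relations x y z,
      generated_by x y z
    & forall (H : groupType) (x' y' z' : H), relations x' y' z' ->
        exists f : {multiplicative G -> H},
          [/\ f x = x', f y = y' & f z = z'] ].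

End Presentation.

(* The cells (n, m, i) with i <= n index the free generators a_{n,m,i}; A is
   the free module on all of them, and A_{n,m} is the submodule of elements
   supported on the cells (n, m, _). *)
Definition cell := {c : nat * nat * nat | (c.2 <= c.1.1)%N}.

Section Resolution.
Variables (q s1 s2 t1 t2 : nat) (G : groupType) (x y z : G).

Let A := {malg 'Z[G][cell]}.

(* The generator a_{n,m,i}, with the convention that it is 0 outside the
   range 0 <= n, 0 <= m, 0 <= i <= n. *)
Definition gen (n m i : int) : A :=
  match n, m, i with
  | Posz n', Posz m', Posz i' =>
      if insub (n', m', i') is Some c then mkmalgU c 1 else 0
  | _, _, _ => 0
  end.

Let X : 'Z[G] := gr_elt x.
Let Y : 'Z[G] := gr_elt y.
Let Z : 'Z[G] := gr_elt z.

Definition L (f j : nat) : 'Z[G] := \sum_(0 <= i < f ^ j) Z ^+ i.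
Definition Nz : 'Z[G] := \sum_(0 <= i < q) Z ^+ i.

(* The four coefficients occurring in d_1, as functions of the exponent m. *)
Definition cX (m : nat) : 'Z[G] := X * L t1 1 ^+ m - 1.
Definition cY (m : nat) : 'Z[G] := Y * L t2 1 ^+ m - 1.
Definition sX (m : nat) : 'Z[G] := \sum_(0 <= j < s1) X ^+ j * L t1 j ^+ m.
Definition sY (m : nat) : 'Z[G] := \sum_(0 <= j < s2) Y ^+ j * L t2 j ^+ m.

(* The integer (t ^ (m s) - 1) / q; the division is exact when
   t ^ s = 1 %[mod q]. *)
Definition cD (t s m : nat) : int :=
  (((t ^ (m * s))%N%:Z - 1) %/ q%:Z)%Z.

Definition d0_gen (n m i : nat) : A :=
  (if odd m then Z - 1 else Nz) *: gen n (m%:Z - 1) i.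

(* n is 2k or 2k+1, i is 2l or 2l+1, but m is 2r or 2r-1: the exponent in
   the coefficients is r = m/2 rounded up. *)
Definition d1_gen (n m i : nat) : A :=
  let k := Posz n./2 in let l := Posz i./2 in
  let r := uphalf m in let r' := Posz r in
  match odd n, odd m, odd i with
  | true, false, false =>
      cY r *: gen (2 * k) (2 * r') (2 * l)
      + sX r *: gen (2 * k) (2 * r') (2 * l - 1)
  | true, false, true =>
      - (sY r *: gen (2 * k) (2 * r') (2 * l + 1))
      + cX r *: gen (2 * k) (2 * r') (2 * l)
  | true, true, false =>
      - (cY r *: gen (2 * k) (2 * r' - 1) (2 * l))
      - sX r *: gen (2 * k) (2 * r' - 1) (2 * l - 1)
  | true, true, true =>
      sY r *: gen (2 * k) (2 * r' - 1) (2 * l + 1)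
      - cX r *: gen (2 * k) (2 * r' - 1) (2 * l)
  | false, false, false =>
      sY r *: gen (2 * k - 1) (2 * r') (2 * l)
      + sX r *: gen (2 * k - 1) (2 * r') (2 * l - 1)
  | false, false, true =>
      - (cY r *: gen (2 * k - 1) (2 * r') (2 * l + 1))
      + cX r *: gen (2 * k - 1) (2 * r') (2 * l)
  | false, true, false =>
      - (sY r *: gen (2 * k - 1) (2 * r' - 1) (2 * l))
      - sX r *: gen (2 * k - 1) (2 * r' - 1) (2 * l - 1)
  | false, true, true =>
      cY r *: gen (2 * k - 1) (2 * r' - 1) (2 * l + 1)
      - cX r *: gen (2 * k - 1) (2 * r' - 1) (2 * l)
  end.

Definition d2_gen (n m i : nat) : A :=
  if odd m then
    let r := uphalf m in
    - ((cD t2 s2 r)%:~R *: gen (n%:Z - 2) (2 * r%:Z) i)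
    - (cD t1 s1 r)%:~R *: gen (n%:Z - 2) (2 * r%:Z) (i%:Z - 2)
  else 0.

Definition on_cells (f : nat -> nat -> nat -> A) (c : cell) : A :=
  let: (n, m, i) := val c in f n m i.

Definition d0 : {linear A -> A} := linext (on_cells d0_gen).
Definition d1 : {linear A -> A} := linext (on_cells d1_gen).
Definition d2 : {linear A -> A} := linext (on_cells d2_gen).
Definition differential : {linear A -> A} := (d0 \+ d1) \+ d2.

End Resolution.

Section Acyclic.
Variable G : groupType.

Let A := {malg 'Z[G][cell]}.

Definition in_degree (k : nat) (c : A) : Prop :=
  forall b : cell, b \in msupp c -> ((val b).1.1 + (val b).1.2)%N = k.

Definition chain_complex (d : {linear A -> A}) : Prop :=
  [/\ forall c, in_degree 0 c -> d c = 0,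
      forall k c, in_degree k.+1 c -> in_degree k (d c)
    & forall c, d (d c) = 0].

Definition exact_in_positive_degrees (d : {linear A -> A}) : Prop :=
  forall k c, (0 < k)%N -> in_degree k c -> d c = 0 ->
    exists2 c', in_degree k.+1 c' & d c' = c.

(* H_0 is the trivial 'Z[G]-module Z: the map eps, which is only relevant on
   degree 0, is 'Z[G]-linear for the trivial action of G on int. *)
Definition augmented_to_trivial (d : {linear A -> A}) : Prop :=
  exists eps : {additive A -> int},
    [/\ forall g c, eps (gr_elt g *: c) = eps c,
        forall k, exists2 c, in_degree 0 c & eps c = k
      & forall c, in_degree 0 c ->
          (eps c = 0 <-> exists2 c', in_degree 1 c' & d c' = c)].

Definition acyclic (d : {linear A -> A}) : Prop :=
  [/\ chain_complex d, exact_in_positive_degrees d & augmented_to_trivial d].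

End Acyclic.

(* Main.v *)
Require Import Defs.
From mathcomp Require Import all_boot all_order all_algebra all_fingroup.
From mathcomp Require Import finmap.
From mathcomp.zify Require Import zify.

(* The element U_m = x L_{t,1}^m satisfies U_m^j = x^j L_{t,j}^m, so the
   coefficients of d_1 are U_m - 1 and 1 + U_m + ... + U_m^(s-1); their product
   is U_m^s - 1 = (t^(ms) - 1)/q N_z, which is what d_0 d_2 + d_2 d_0 cancels.
   Since (z - 1) U_m = U_(m+1) (z - 1) and N_z commutes with U_m, the maps d_0
   and d_1 anticommute; hence d^2 = 0.

   For exactness, order the cells lexicographically by (n, i).  The coefficient
   w of the top cell of a cycle satisfies w (z - 1) = 0 or w N_z = 0 if m > 0;
   if m = 0 it satisfies the same kind of equation for y modulo Z[G](z - 1) when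
   i < n, and for x modulo Z[G](z - 1) + Z[G](y - 1) when i = n.  The normal
   form x^a y^b z^c in G makes these cyclic resolutions exact, so the top
   coefficient can be removed by subtracting a boundary. *)

Set Implicit Arguments.
Unset Strict Implicit.
Unset Printing Implicit Defensive.

Import GRing.Theory.

(** * Geometric sums in a noncommutative ring *)

Section GeometricSums.
Local Open Scope ring_scope.
Variable R : nzRingType.
Implicit Types u v w : R.

Definition geom u n : R := \sum_(0 <= i < n) u ^+ i.

Lemma geomS u n : geom u n.+1 = geom u n + u ^+ n.
Proof. by rewrite /geom big_nat_recr. Qed.

Lemma geom0 u : geom u 0 = 0.
Proof. by rewrite /geom big_geq. Qed.

Lemma comm_geom u v n : GRing.comm u v -> GRing.comm u (geom v n).
Proof. by move=> uv; apply: commr_sum => i _; apply: commrX. Qed.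

Lemma geom_subr1 u n : (u - 1) * geom u n = u ^+ n - 1.
Proof. by rewrite subrX1 /geom big_mkord. Qed.

Lemma subr1_geom u n : geom u n * (u - 1) = u ^+ n - 1.
Proof.
rewrite -geom_subr1; apply: commr_sym.
by apply: comm_geom; apply: commr_sym; apply: commrB; [|exact: commr1].
Qed.

Lemma geomD u m n : geom u (m + n) = geom u m + u ^+ m * geom u n.
Proof.
elim: n => [|n IH]; first by rewrite addn0 geom0 mulr0 addr0.
by rewrite addnS !geomS IH mulrDr exprD addrA.
Qed.

Lemma geom_mul u m n : geom u m * geom (u ^+ m) n = geom u (m * n).
Proof.
elim: n => [|n IH]; first by rewrite muln0 !geom0 mulr0.
rewrite geomS mulrDr IH mulnS addnC geomD -exprM; congr (_ + _).
by apply: commr_sym; apply: comm_geom; apply: commr_sym; apply: commrX.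
Qed.

Lemma conjX u v w n : u * w = w * v -> u ^+ n * w = w * v ^+ n.
Proof.
move=> uwv; elim: n => [|n IH]; first by rewrite !expr0 mul1r mulr1.
by rewrite exprSr -mulrA uwv mulrA IH -mulrA -exprSr.
Qed.

Lemma conj_sum (I : Type) (r : seq I) (F H : I -> R) w :
  (forall i, F i * w = w * H i) ->
  (\sum_(i <- r) F i) * w = w * (\sum_(i <- r) H i).
Proof. by move=> FH; rewrite mulr_suml mulr_sumr; apply: eq_bigr. Qed.

Lemma conj_geom u v w n : u * w = w * v -> geom u n * w = w * geom v n.
Proof. by move=> uwv; apply: conj_sum => i; apply: conjX. Qed.

(** [u ^+ n - 1] has [u - 1] as a left factor, and [geom u q * (u - 1) = u ^+ q - 1 = 0]. *)
Lemma geom_id u q n : u ^+ q = 1 -> geom u q * u ^+ n = geom u q.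
Proof.
move=> uq1; apply/eqP; rewrite -subr_eq0 -[X in _ - X]mulr1 -mulrBr subrX1.
by rewrite mulrA subr1_geom uq1 subrr mul0r.
Qed.

Lemma geom_sqr u q : u ^+ q = 1 -> geom u q * geom u q = q%:R * geom u q.
Proof.
move=> uq1; rewrite {2}/geom mulr_sumr; under eq_bigr do rewrite geom_id //.
by rewrite sumr_const_nat subn0 mulr_natl.
Qed.

End GeometricSums.

(** * The twisted elements U_m and their powers *)

Section MetacyclicRelations.
Local Open Scope ring_scope.
Variables (R : nzRingType) (q s t : nat) (X Z : R).
Hypotheses (q_gt0 : (0 < q)%N) (s_gt0 : (0 < s)%N) (t_gt0 : (0 < t)%N)
  (ts : t ^ s = 1 %[mod q]).
Hypotheses (Xs : X ^+ s = 1) (Zq : Z ^+ q = 1) (ZX : Z * X = X * Z ^+ t).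

Local Notation L j := (geom Z (t ^ j)).

(* The element x L_{t,1}^m whose powers are the x^j L_{t,j}^m. *)
Definition twist m : R := X * L 1 ^+ m.

(** Moving [L j] to the right across [X] turns it into a geometric sum in [Z ^+ t]; this commutes
    with [L 1], and their product is [L j.+1] by [geom_mul]. *)
Lemma twistX m j : twist m ^+ j = X ^+ j * L j ^+ m.
Proof.
elim: j => [|j IH].
  by rewrite !expr0 mul1r expn0 /geom big_nat1 expr0 expr1n.
rewrite exprSr IH /twist !mulrA -(mulrA (X ^+ j)).
rewrite (conjX m (conj_geom (t ^ j) ZX)) mulrA -exprSr -mulrA; congr (_ * _).
have comL : GRing.comm (geom (Z ^+ t) (t ^ j)) (L 1).
  by apply: comm_geom; apply: commr_sym; apply: comm_geom; apply: commrX.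
by rewrite -exprMn_comm // comL expn1 geom_mul -expnS.
Qed.

Lemma sum_twist m : geom (twist m) s = \sum_(0 <= j < s) X ^+ j * L j ^+ m.
Proof. by apply: eq_bigr => j _; rewrite twistX. Qed.

(** Crossing [X] replaces [Z - 1] by [Z ^+ t - 1 = L 1 * (Z - 1)], which supplies one more factor
    [L 1]. *)
Lemma subr1_twist m : (Z - 1) * twist m = twist m.+1 * (Z - 1).
Proof.
rewrite /twist mulrA mulrBl ZX mul1r -[X in _ - X]mulr1 -mulrBr.
rewrite -!mulrA; congr (_ * _); rewrite exprSr -mulrA [L 1]/(geom _ _) expn1.
rewrite subr1_geom; apply: commrX; apply: comm_geom; apply: commr_sym.
by apply: commrB; [apply: commrX|exact: commr1].
Qed.

(** Multiplication by t permutes the residues modulo q, with inverse multiplication by [t ^ s.-1],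
    so the sum is only reordered. *)
Lemma geom_conj_perm : geom (Z ^+ t) q = geom Z q.
Proof.
have tK i : (t ^ s.-1 * (t * i) = i %[mod q])%N.
  by rewrite mulnA -expnSr prednK // -modnMml ts modnMml mul1n.
pose h (i : 'I_q) := Ordinal (ltn_pmod (t * i) q_gt0).
have h_inj : injective h.
  move=> i j /(congr1 val) /= hij; apply: val_inj => /=.
  rewrite -(modn_small (ltn_ord i)) -(modn_small (ltn_ord j)).
  by rewrite -[LHS]tK -[RHS]tK -modnMmr hij modnMmr.
rewrite /geom !big_mkord [RHS](reindex_inj h_inj) /=.
by apply: eq_bigr => i _; rewrite -exprM expr_mod.
Qed.

Lemma geom_twist m : geom Z q * twist m = twist m * geom Z q.
Proof.
rewrite /twist mulrA (conj_geom q ZX) geom_conj_perm -!mulrA.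
congr (_ * _); apply: commrX; apply: comm_geom; apply: commr_sym.
exact: comm_geom.
Qed.

(** Since N_z^2 = q N_z, the powers of 1 + c N_z run parallel to those of the integer 1 + c q, and
    one e serves both. *)
Lemma geom_pow1D c m :
  exists2 e, (1 + c%:R * geom Z q) ^+ m = 1 + e%:R * geom Z q
           & ((1 + c * q) ^ m = 1 + e * q)%N.
Proof.
elim: m => [|m [e IH1 IH2]].
  by exists 0%N; rewrite ?expr0 ?mul0r ?addr0 ?expn0.
exists (e + c + e * c * q)%N; last first.
  by rewrite expnSr IH2; clear; lia.
rewrite exprSr IH1 mulrDl mul1r mulrDr mulr1.
have -> : e%:R * geom Z q * (c%:R * geom Z q) = (e * c * q)%:R * geom Z q.
  rewrite mulrA -(mulrA e%:R) (commr_nat (geom Z q) c) mulrA -natrM.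
  by rewrite -mulrA geom_sqr // mulrA -natrM.
by rewrite !natrD !mulrDl -!addrA; congr (_ + _); rewrite addrCA.
Qed.

Lemma twist_top m :
  twist m ^+ s = 1 + (((t ^ (m * s))%N%:Z - 1) %/ q%:Z)%Z%:~R * geom Z q.
Proof.
have [c tsE] : exists c, (t ^ s = 1 + c * q)%N.
  have ts_gt0 : (0 < t ^ s)%N.
    by rewrite expn_gt0 t_gt0.
  have /dvdnP[c cE] : (q %| t ^ s - 1)%N by rewrite -eqn_mod_dvd // ts.
  by exists c; rewrite -cE subnKC.
(* The 1 + c q terms form c full periods of z, each summing to N_z, and one last term z^(cq) = 1. *)
have LsE : L s = 1 + c%:R * geom Z q.
  rewrite tsE add1n geomS addrC mulnC -geom_mul exprM Zq expr1n /(geom 1 _).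
  under eq_bigr do rewrite expr1n.
  by rewrite sumr_const_nat subn0 (commr_nat (geom Z q)).
rewrite twistX Xs mul1r LsE; have [e -> eE] := geom_pow1D c m.
rewrite mulnC expnM tsE eE PoszD addrAC subrr add0r PoszM mulzK //.
by rewrite -lt0n.
Qed.

End MetacyclicRelations.

(** * Commutation of the x and y twists *)

Section CommutingTwists.
Local Open Scope ring_scope.
Variables (R : nzRingType) (t1 t2 : nat) (X Y Z : R).
Hypotheses (XY : X * Y = Y * X).
Hypotheses (ZX : Z * X = X * Z ^+ t1) (ZY : Z * Y = Y * Z ^+ t2).

(** Either product is xy times the m-th power of the geometric sum of length t1 t2, because xy =
    yx. *)
Lemma comm_twist m : GRing.comm (twist t1 X Z m) (twist t2 Y Z m).
Proof.
have twistM t t' (V W : R) : Z * W = W * Z ^+ t' ->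
    twist t V Z m * twist t' W Z m = V * W * geom Z (t' * t) ^+ m.
  move=> ZW; rewrite /twist !expn1 !mulrA -(mulrA V).
  rewrite (conjX m (conj_geom t ZW)) mulrA -!mulrA; congr (_ * (_ * _)).
  have comL : GRing.comm (geom (Z ^+ t') t) (geom Z t').
    by apply: comm_geom; apply: commr_sym; apply: comm_geom; apply: commrX.
  by rewrite -exprMn_comm // comL geom_mul.
by rewrite /GRing.comm !twistM // XY mulnC.
Qed.

End CommutingTwists.

(** * Coefficients of the periodic cyclic resolutions *)

Section CyclicCoefficients.
Local Open Scope ring_scope.
Variable R : nzRingType.
Implicit Types U V W : R.

(* The differentials of the periodic resolution of a cyclic group of order s
   generated by U, with the convention that degree 0 maps to 0. *)
Definition cyc U (s a : nat) : R :=
  if a == 0%N then 0 else if odd a then U - 1 else geom U s.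

Lemma cyc0 U s : cyc U s 0 = 0. Proof. by []. Qed.

Lemma cyc_cyc U s a :
  cyc U s a * cyc U s a.-1 = if (1 < a)%N then U ^+ s - 1 else 0.
Proof.
case: a => [|[|a]]; rewrite /cyc /= ?mul0r ?mulr0 //.
by case: (odd a); rewrite /= ?subr1_geom ?geom_subr1.
Qed.

Lemma comm_cyc U V s s' a b :
  GRing.comm U V -> GRing.comm (cyc U s a) (cyc V s' b).
Proof.
move=> UV.
have commC (A B : R) n c : GRing.comm A B -> GRing.comm A (cyc B n c).
  move=> AB; rewrite /cyc; case: eqP => _; first exact: commr0.
  case: (odd c); last exact: comm_geom.
  by apply: commrB; [|exact: commr1].
by apply/commC/commr_sym/commC/commr_sym.
Qed.

Lemma cyc_conj U V W s a : W * V = U * W -> W * cyc V s a = cyc U s a * W.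
Proof.
move=> WV; rewrite /cyc; case: eqP => _; first by rewrite mulr0 mul0r.
case: (odd a); first by rewrite mulrBl mulrBr WV mul1r mulr1.
by rewrite (conj_geom s (esym WV)).
Qed.

End CyclicCoefficients.

(** * Coefficients of d and the identity d^2 = 0 *)

Section TotalDifferential.
Local Open Scope ring_scope.
Variables (R : nzRingType) (q s1 s2 t1 t2 : nat) (X Y Z : R).
Hypotheses (q_gt0 : (0 < q)%N) (s1_gt0 : (0 < s1)%N) (s2_gt0 : (0 < s2)%N).
Hypotheses (t1_gt0 : (0 < t1)%N) (t2_gt0 : (0 < t2)%N).
Hypotheses (t1s1 : t1 ^ s1 = 1 %[mod q]) (t2s2 : t2 ^ s2 = 1 %[mod q]).
Hypotheses (Xs : X ^+ s1 = 1) (Ys : Y ^+ s2 = 1) (Zq : Z ^+ q = 1).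
Hypotheses (XY : X * Y = Y * X).
Hypotheses (ZX : Z * X = X * Z ^+ t1) (ZY : Z * Y = Y * Z ^+ t2).

(** In the coordinates a = i, b = n - i of a_{n,m,i}, the parity cases of d_1 merge into an x part
    lowering a and a y part lowering b. The sign (-1)^m makes d_1 anticommute with d_0, and (-1)^a
    makes the x and y parts anticommute. *)
Definition dcoefZ m : R := cyc Z q m.
Definition dcoefX a m : R := (-1) ^+ m * cyc (twist t1 X Z (uphalf m)) s1 a.
Definition dcoefY a b m : R :=
  (-1) ^+ (m + a) * cyc (twist t2 Y Z (uphalf m)) s2 b.
(** Serves both terms of d_2, with (t1, s1, a) or (t2, s2, b). The test [1 < a] encodes the
    vanishing of generators outside the range, since [a.-2] truncates. *)
Definition dcoefD t s a m : R :=
  if odd m && (1 < a)%N then - (cD q t s (uphalf m))%:~R else 0.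

Lemma dcoefD_out t s a m :
  ~~ (odd m && (1 < a)%N) -> dcoefD t s a m = 0.
Proof. by rewrite /dcoefD => /negPf->. Qed.

Lemma dcoefD_in t s a m :
  odd m -> (1 < a)%N -> dcoefD t s a m = - (cD q t s (uphalf m))%:~R.
Proof. by rewrite /dcoefD => -> ->. Qed.

Lemma scale_dcoefX (V : lmodType R) a m (v : V) : dcoefX a m *: v =
  (if odd m then -%R else id) (cyc (twist t1 X Z (uphalf m)) s1 a *: v).
Proof. by rewrite /dcoefX -signr_odd -scalerA scaler_sign; case: odd. Qed.

Lemma scale_dcoefY (V : lmodType R) a b m (v : V) : dcoefY a b m *: v =
  (if odd m (+) odd a then -%R else id)
    (cyc (twist t2 Y Z (uphalf m)) s2 b *: v).
Proof.
by rewrite /dcoefY -signr_odd -scalerA scaler_sign oddD; case: addb.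
Qed.

Lemma dcoefZZ m : dcoefZ m * dcoefZ m.-1 = 0.
Proof. by rewrite /dcoefZ cyc_cyc Zq subrr if_same. Qed.

(** For m = 2r - 1, moving z - 1 across U_(r-1) yields U_r; for m = 2r > 0, N_z commutes with U_r.
    The [uphalf] indices cover both cases. *)
Lemma dcoefZ_twist s t (W : R) m : (0 < s)%N -> t ^ s = 1 %[mod q] ->
  Z * W = W * Z ^+ t ->
  dcoefZ m * twist t W Z (uphalf m.-1) = twist t W Z (uphalf m) * dcoefZ m.
Proof.
move=> s_gt0 ts ZW; case: m => [|m]; first by rewrite mul0r mulr0.
rewrite /dcoefZ /cyc /= uphalfE /=.
case: (boolP (odd m)) => [odd_m|/negPf even_m] /=.
  rewrite (_ : uphalf m = m./2.+1) ?uphalf_half ?odd_m //.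
  exact: geom_twist q_gt0 s_gt0 ts Zq ZW _.
by rewrite uphalf_half even_m subr1_twist.
Qed.

Lemma dcoefZX a m : dcoefZ m * dcoefX a m.-1 + dcoefX a m * dcoefZ m = 0.
Proof.
case: m => [|m]; first by rewrite /dcoefZ cyc0 mul0r mulr0 addr0.
rewrite /dcoefX /= exprS mulN1r !mulNr -!mulrA.
rewrite -(cyc_conj _ _ (dcoefZ_twist m.+1 s1_gt0 t1s1 ZX)) /=.
by rewrite !mulrA (commr_sign (dcoefZ m.+1) m) subrr.
Qed.

Lemma dcoefZY a b m : dcoefZ m * dcoefY a b m.-1 + dcoefY a b m * dcoefZ m = 0.
Proof.
case: m => [|m]; first by rewrite /dcoefZ cyc0 mul0r mulr0 addr0.
rewrite /dcoefY /= addSn exprS mulN1r !mulNr -!mulrA.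
rewrite -(cyc_conj _ _ (dcoefZ_twist m.+1 s2_gt0 t2s2 ZY)) /=.
by rewrite !mulrA (commr_sign (dcoefZ m.+1) (m + a)) subrr.
Qed.

Lemma dcoefXY a b m :
  dcoefX a m * dcoefY a.-1 b m + dcoefY a b m * dcoefX a m = 0.
Proof.
case: a => [|a]; first by rewrite /dcoefX cyc0 mulr0 mul0r mulr0 addr0.
rewrite /dcoefX /dcoefY /= addnS exprS mulN1r !mulNr -!mulrA.
set u := cyc _ s1 _; set v := cyc _ s2 _.
have uv : u * v = v * u by apply/comm_cyc/(comm_twist XY ZX ZY).
rewrite (mulrA u) (commr_sign u) (mulrA v) (commr_sign v) -!mulrA uv.
by rewrite !mulrA -!exprD addnC subrr.
Qed.

(** Two consecutive cyclic coefficients multiply to U^s - 1, an integer multiple of N_z. The parity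
    of m leaves at most one of the two d_2 terms, which cancels this multiple. *)
Lemma dcoef_square s t a m (W : R) :
    (0 < s)%N -> (0 < t)%N -> t ^ s = 1 %[mod q] -> W ^+ s = 1 ->
    Z * W = W * Z ^+ t ->
  cyc (twist t W Z (uphalf m)) s a * cyc (twist t W Z (uphalf m)) s a.-1
    + dcoefZ m * dcoefD t s a m.-1 + dcoefD t s a m * dcoefZ m.+1 = 0.
Proof.
move=> s_gt0 t_gt0 ts Ws ZW; rewrite cyc_cyc /dcoefD.
case: (ltnP 1 a) => _; last by rewrite !andbF mulr0 mul0r !addr0.
rewrite (twist_top q_gt0 t_gt0 ts Ws Zq ZW) [1 + _]addrC addrK -/(cD q t s _).
rewrite !andbT; case: m => [|m].
  (* For m = 0 no d_2 term survives, and the multiple of N_z is already 0. *)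
  rewrite /dcoefZ cyc0 !mul0r !addr0 /cD mul0n expn0 subrr div0z.
  by rewrite mulr0z mul0r.
rewrite /dcoefZ /cyc /=; case: (boolP (odd m)) => [odd_m|/negPf even_m] /=.
  rewrite mul0r addr0 uphalfE /= (uphalf_half m) odd_m add1n.
  by rewrite mulrN (commr_int (geom Z q)) subrr.
by rewrite mulr0 addr0 mulNr subrr.
Qed.

Lemma dcoefXX a m :
  dcoefX a m * dcoefX a.-1 m + dcoefZ m * dcoefD t1 s1 a m.-1
    + dcoefD t1 s1 a m * dcoefZ m.+1 = 0.
Proof.
rewrite -[RHS](dcoef_square a m s1_gt0 t1_gt0 t1s1 Xs ZX); congr (_ + _ + _).
rewrite /dcoefX -mulrA (mulrA _ (_ ^+ m)) (commr_sign _ m) -mulrA mulrA.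
by rewrite -expr2 sqrr_sign mul1r.
Qed.

Lemma dcoefYY a b m :
  dcoefY a b m * dcoefY a b.-1 m + dcoefZ m * dcoefD t2 s2 b m.-1
    + dcoefD t2 s2 b m * dcoefZ m.+1 = 0.
Proof.
rewrite -[RHS](dcoef_square b m s2_gt0 t2_gt0 t2s2 Ys ZY); congr (_ + _ + _).
rewrite /dcoefY -mulrA (mulrA _ (_ ^+ (m + a))) (commr_sign _ (m + a)).
by rewrite -mulrA mulrA -expr2 sqrr_sign mul1r.
Qed.

Lemma comm_coefD t s a m (u : R) : GRing.comm u (dcoefD t s a m).
Proof.
rewrite /dcoefD; case: ifP => _; last exact: commr0.
by apply: commrN; apply: commr_int.
Qed.

Lemma dcoefDD t s t' s' a b m : dcoefD t s a m * dcoefD t' s' b m.+1 = 0.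
Proof. by rewrite /dcoefD /=; case: (odd m); rewrite ?mul0r ?mulr0. Qed.

Lemma odd_coefDr (u v : R) t s a m :
  (odd m -> u = - v) -> u * dcoefD t s a m + dcoefD t s a m * v = 0.
Proof.
move=> uv; case: (boolP (odd m)) => [/uv->|/negPf even_m].
  by rewrite mulNr comm_coefD addNr.
by rewrite /dcoefD even_m mulr0 mul0r addr0.
Qed.

(** For odd m, the indices m and m + 1 share the twist exponent (m + 1)/2, so only the sign (-1)^m
    changes. *)
Lemma dcoefX_succ a m : odd m -> dcoefX a m = - dcoefX a m.+1.
Proof.
move=> odd_m; rewrite /dcoefX exprS mulN1r mulNr opprK.
by rewrite uphalfE /= uphalf_half odd_m.
Qed.

Lemma dcoefY_succ a b m : odd m -> dcoefY a b m = - dcoefY a b m.+1.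
Proof.
move=> odd_m; rewrite /dcoefY addSn exprS mulN1r mulNr opprK.
by rewrite uphalfE /= uphalf_half odd_m.
Qed.

Lemma dcoefXD a m :
  dcoefX a m * dcoefD t1 s1 a.-1 m + dcoefD t1 s1 a m * dcoefX a.-2 m.+1 = 0.
Proof.
(* Up to a = 2 each product has a zero factor; beyond, [cyc] has period 2 and does not see the shift
   by two. *)
have [le_a2|lt2a] := leqP a 2.
  case: a le_a2 => [|[|[|a]]] // _; rewrite /dcoefD /dcoefX /cyc /=;
  by rewrite ?andbF ?mulr0 ?mul0r ?addr0.
have -> : dcoefD t1 s1 a.-1 m = dcoefD t1 s1 a m.
  by case: a lt2a => [|[|[|a]]].
have -> : dcoefX a.-2 m.+1 = dcoefX a m.+1.
  by rewrite /dcoefX /cyc; case: a lt2a => [|[|[|a]]] //= _; rewrite !negbK.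
exact/odd_coefDr/dcoefX_succ.
Qed.

Lemma dcoefYD a b m :
  dcoefY a b m * dcoefD t2 s2 b.-1 m + dcoefD t2 s2 b m * dcoefY a b.-2 m.+1
    = 0.
Proof.
have [le_b2|lt2b] := leqP b 2.
  case: b le_b2 => [|[|[|b]]] // _; rewrite /dcoefD /dcoefY /cyc /=;
  by rewrite ?andbF ?mulr0 ?mul0r ?addr0.
have -> : dcoefD t2 s2 b.-1 m = dcoefD t2 s2 b m.
  by case: b lt2b => [|[|[|b]]].
have -> : dcoefY a b.-2 m.+1 = dcoefY a b m.+1.
  by rewrite /dcoefY /cyc; case: b lt2b => [|[|[|b]]] //= _; rewrite !negbK.
exact/odd_coefDr/dcoefY_succ.
Qed.

Lemma dcoefXD' a b m :
  dcoefX a m * dcoefD t2 s2 b m + dcoefD t2 s2 b m * dcoefX a m.+1 = 0.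
Proof. exact/odd_coefDr/dcoefX_succ. Qed.

Lemma dcoefYD' a b m :
  dcoefY a b m * dcoefD t1 s1 a m + dcoefD t1 s1 a m * dcoefY a.-2 b m.+1 = 0.
Proof.
have [le_a1|lt1a] := leqP a 1.
  by rewrite /dcoefD ltnNge le_a1 andbF mulr0 mul0r addr0.
have -> : dcoefY a.-2 b m.+1 = dcoefY a b m.+1.
  rewrite /dcoefY; congr (_ * _); case: a lt1a => [|[|a]] // _.
  by rewrite !addnS !exprS !mulN1r !opprK.
exact/odd_coefDr/dcoefY_succ.
Qed.

Lemma dcoefX0 a : dcoefX a 0 = cyc X s1 a.
Proof. by rewrite /dcoefX /twist mul1r mulr1. Qed.

Lemma mulr_signK a (u v : R) : u * (-1) ^+ a * ((-1) ^+ a * v) = u * v.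
Proof. by rewrite mulrA -(mulrA u) -expr2 sqrr_sign mulr1. Qed.

Lemma dcoefY0 a b : dcoefY a b 0 = (-1) ^+ a * cyc Y s2 b.
Proof. by rewrite /dcoefY /twist mulr1. Qed.

Lemma dcoefZ_exact :
    (forall w m, (0 < m)%N -> w * cyc Z q m = 0 ->
       exists w', w = w' * cyc Z q m.+1) ->
  forall w m, w * dcoefZ m.+1 = 0 -> exists w', w = w' * dcoefZ m.+2.
Proof. by move=> exZ w m /exZ; apply. Qed.

(** At m = 0 the twist is y itself, and the central sign (-1)^a, of square 1, is absorbed into the
    multipliers. *)
Lemma dcoefY_exact :
    (forall v w b, (0 < b)%N -> v * (Z - 1) + w * cyc Y s2 b = 0 ->
       exists w1 w2, w = w1 * cyc Y s2 b.+1 + w2 * (Z - 1)) ->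
  forall v w a b, v * dcoefZ 1 + w * dcoefY a b.+1 0 = 0 ->
    exists w1 w2, w = w1 * dcoefY a b.+2 0 + w2 * dcoefZ 1.
Proof.
move=> exY v w a b; rewrite !dcoefY0 mulrA => /exY[//|w1 [w2 wE]].
exists w1, (w2 * (-1) ^+ a).
rewrite -[LHS]mulr1 -[X in _ * X = _](sqrr_sign R a) expr2 mulrA wE mulrDl.
by rewrite -!mulrA !(commr_sign _ a).
Qed.

Lemma dcoefX_exact :
    (forall v1 v2 w a, (0 < a)%N ->
       v1 * (Z - 1) + v2 * (Y - 1) + w * cyc X s1 a = 0 ->
       exists w1 w2 w3,
         w = w1 * cyc X s1 a.+1 + w2 * (Y - 1) + w3 * (Z - 1)) ->
  forall v1 v2 w a,
    v1 * dcoefZ 1 + v2 * dcoefY a 1 0 + w * dcoefX a.+1 0 = 0 ->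
    exists w1 w2 w3,
      w = w1 * dcoefX a.+2 0 + w2 * dcoefY a.+1 1 0 + w3 * dcoefZ 1.
Proof.
move=> exX v1 v2 w a; rewrite !dcoefX0 !dcoefY0 (mulrA v2).
move=> /exX[//|w1 [w2 [w3 ->]]]; exists w1, (w2 * (-1) ^+ a.+1), w3.
by rewrite mulr_signK.
Qed.

Lemma dcoef_exact0 (P : R -> Prop) :
    (forall w, P w -> exists w1 w2 w3,
       w = w1 * (X - 1) + w2 * (Y - 1) + w3 * (Z - 1)) ->
  forall w, P w -> exists w1 w2 w3,
    w = w1 * dcoefX 1 0 + w2 * dcoefY 0 1 0 + w3 * dcoefZ 1.
Proof.
move=> ex0 w /ex0[w1 [w2 [w3 ->]]]; exists w1, w2, w3.
by rewrite dcoefX0 dcoefY0 mul1r.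
Qed.

Variables (V : lmodType R) (e : nat -> nat -> nat -> V) (d : {linear V -> V}).
Hypothesis dE : forall a b m,
  d (e a b m) = dcoefZ m *: e a b m.-1
    + dcoefX a m *: e a.-1 b m + dcoefY a b m *: e a b.-1 m
    + dcoefD t1 s1 a m *: e a.-2 b m.+1 + dcoefD t2 s2 b m *: e a b.-2 m.+1.

Lemma d_basis_sqr a b m : d (d (e a b m)) = 0.
Proof.
(* d_2 after d_0 yields the index [m.-1.+1], which differs from m only at m = 0, where [dcoefZ m] is
   0. *)
have eZ (v : R) i j :
    (dcoefZ m * v) *: e i j m.-1.+1 = (dcoefZ m * v) *: e i j m.
  by case: (m) => //; rewrite /dcoefZ cyc0 mul0r !scale0r.
rewrite dE !linearD !linearZ /= !dE !scalerDr !scalerA !eZ /=.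
(* The 25 composites are regrouped so that each group has a common target and vanishes by one of the
   identities above. *)
rewrite [LHS](AC (5*5*5*5*5)
  (1*(2*6)*(3*11)*(8*12)*(7*4*16)*(13*5*21)*(9*17)*(10*22)*(14*18)*(15*23)
   *19*20*24*25)) /=.
rewrite -!scalerDl dcoefZZ dcoefZX dcoefZY dcoefXY dcoefXX dcoefYY dcoefXD.
by rewrite dcoefXD' dcoefYD dcoefYD' !dcoefDD !scale0r !addr0.
Qed.

End TotalDifferential.

(** * Group elements in Z[G] and additive extension *)

Section GroupRingElements.
Local Open Scope ring_scope.
Variable G : groupType.
Implicit Types (g h : G) (w : 'Z[G]).

Lemma gr_eltM g h : gr_elt (g * h)%g = gr_elt g * gr_elt h.
Proof. by rewrite [RHS]gr_mulUU mulr1. Qed.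

Lemma gr_eltX g n : gr_elt (g ^+ n)%g = gr_elt g ^+ n.
Proof.
by elim: n => [|n IH]; rewrite ?expg0 // expgS exprS gr_eltM IH.
Qed.

(** Closure under differences gives 0, opposites and sums, hence all integer combinations of group
    elements. *)
Lemma group_ring_ind (P : 'Z[G] -> Prop) :
  (forall v w, P v -> P w -> P (v - w)) -> (forall g, P (gr_elt g)) ->
  forall w, P w.
Proof.
move=> PB Pg w.
have P0 : P 0 by rewrite -(subrr (gr_elt 1%g)); apply: PB.
have PN v : P v -> P (- v) by rewrite -sub0r; apply: PB.
have PD v v' : P v -> P v' -> P (v + v').
  by move=> Pv Pv'; rewrite -[v']opprK; apply/PB/PN.
rewrite [w]monalgE; elim/big_ind: _ => // g _.
have PU n : P (mkmalgU g n%:Z).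
  elim: n => [|n IH]; first by rewrite monalgU0.
  by rewrite -addn1 PoszD monalgUD; apply: PD; last apply: Pg.
by case: (w@_g) => n //; rewrite NegzE monalgUN; apply: PN.
Qed.

(** The casts to [{malg int[G]}] expose the scaling by integers, over which [linext] extends f. *)
Definition gr_lin (f : G -> 'Z[G]) : {additive 'Z[G] -> 'Z[G]} :=
  linext (f : G -> {malg int[G]}) : {linear {malg int[G]} -> {malg int[G]}}.

Lemma gr_linE f g : gr_lin f (gr_elt g) = f g.
Proof. exact: linextU. Qed.

End GroupRingElements.

(** * Contracting homotopies for a cyclic factor *)

Section CyclicHomotopy.
Local Open Scope ring_scope.
(** [p] cuts a normal form after its power of u, [p'] before it, and [e] is the exponent of u.
    Applying [P p] stands for working modulo the generators further to the right. *)
Variables (G : groupType) (u : G) (s : nat) (p p' : G -> G) (e : G -> nat).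
Hypotheses (pE : forall g, p g = (p' g * u ^+ e g)%g)
  (e_lt : forall g, (e g < s)%N).
Hypotheses (p'u : forall g, p' (g * u)%g = p' g)
  (eu : forall g, e (g * u)%g = ((e g).+1 %% s)%N).
Hypotheses (p'p : forall g, p' (p g) = p' g) (ep : forall g, e (p g) = e g).

Local Notation U := (gr_elt u).
Local Notation P f := (gr_lin (fun g => gr_elt (f g))).

(** The classical homotopy of the periodic resolution: [h0] undoes U - 1 by partial geometric sums,
    and [h1] undoes the norm by detecting the exponent s - 1. *)
Let h0 := gr_lin (fun g => gr_elt (p' g) * geom U (e g)).
Let h1 := gr_lin (fun g => if (e g).+1 == s then gr_elt (p' g) else 0).

Lemma proj_mul_subr1 w : P p' (w * (U - 1)) = 0.
Proof.
elim/group_ring_ind: w => [v w IHv IHw|g].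
  by rewrite mulrBl raddfB IHv IHw subr0.
by rewrite mulrBr mulr1 -gr_eltM raddfB !gr_linE p'u subrr.
Qed.

Lemma proj_proj w : P p' (P p w) = P p' w.
Proof.
elim/group_ring_ind: w => [v w IHv IHw|g]; first by rewrite !raddfB IHv IHw.
by rewrite !gr_linE p'p.
Qed.

Let h0_proj w : h0 (P p w) = h0 w.
Proof.
elim/group_ring_ind: w => [v w IHv IHw|g]; first by rewrite !raddfB IHv IHw.
by rewrite !gr_linE p'p ep.
Qed.

Let h1_proj w : h1 (P p w) = h1 w.
Proof.
elim/group_ring_ind: w => [v w IHv IHw|g]; first by rewrite !raddfB IHv IHw.
by rewrite !gr_linE p'p ep.
Qed.

Let homotopy0 w : P p w = h0 w * (U - 1) + P p' w.
Proof.
elim/group_ring_ind: w => [v w IHv IHw|g].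
  by rewrite !raddfB IHv IHw mulrBl opprD addrACA.
rewrite !gr_linE -mulrA subr1_geom -gr_eltX mulrBr mulr1 subrK -gr_eltM.
by rewrite pE.
Qed.

Let homotopy1 w : P p w = h1 w * geom U s + h0 (w * (U - 1)).
Proof.
elim/group_ring_ind: w => [v w IHv IHw|g].
  by rewrite !raddfB IHv IHw !mulrBl raddfB opprD addrACA.
rewrite mulrBr mulr1 -gr_eltM raddfB !gr_linE p'u eu pE gr_eltM gr_eltX.
(* At e g = s - 1 the exponent of g u wraps to 0, so [h0] gives 0 and [h1] supplies the full norm;
   otherwise the geometric sums telescope. *)
have := e_lt g; rewrite leq_eqVlt => /orP[/eqP es|lt_es].
  rewrite es modnn eqxx geom0 mulr0 sub0r -es geomS mulrDr.
  by rewrite addrAC subrr add0r.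
rewrite (ltn_eqF lt_es) modn_small // mul0r add0r geomS mulrDr.
by rewrite addrAC subrr add0r.
Qed.

Let homotopy2 w : h1 (w * geom U s) = P p' w.
Proof.
elim/group_ring_ind: w => [v w IHv IHw|g].
  by rewrite mulrBl !raddfB IHv IHw.
have euX j : e (g * u ^+ j)%g = ((e g + j) %% s)%N /\ p' (g * u ^+ j)%g = p' g.
  elim: j => [|j [IHe IHp]]; first by rewrite mulg1 addn0 modn_small.
  by rewrite expgSr mulgA eu p'u IHe IHp addnS -addn1 modnDml addn1.
(* The only j < s for which g u^j has exponent s - 1. *)
have lt_j : (s.-1 - e g < s)%N by have := e_lt g; lia.
rewrite mulr_sumr raddf_sum big_mkord (bigD1 (Ordinal lt_j)) //= big1 => [|j].
  rewrite addr0 -gr_eltX -gr_eltM !gr_linE !(euX _).1 !(euX _).2.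
  rewrite (_ : (e g + (s.-1 - e g) = s.-1)%N); last by have := e_lt g; lia.
  rewrite modn_small ?prednK ?eqxx //; have := e_lt g; lia.
move=> /negP neq_j; rewrite -gr_eltX -gr_eltM gr_linE (euX _).1.
case: eqP => // eq_s; case: neq_j; apply/eqP/val_inj => /=.
have := e_lt g; have := ltn_ord j; have [lt|ge] := ltnP (e g + j) s.
  by move: eq_s; rewrite modn_small //; lia.
move=> ? ?; move: eq_s; rewrite -(subnK ge) modnDr modn_small; lia.
Qed.

Lemma proj_decomp w : exists w', P p w = w' * (U - 1) + P p' w.
Proof. by exists (h0 w). Qed.

(** [h0] and [h1] factor through [P p], so the hypothesis annihilates the remainder in the homotopy
    identity and leaves the wanted multiple. *)
Lemma proj_cyc_exact w a : (0 < a)%N ->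
  P p (w * cyc U s a) = 0 -> exists w', P p w = w' * cyc U s a.+1.
Proof.
have cycS : cyc U s a.+1 = if odd a then geom U s else U - 1.
  by rewrite /cyc /=; case: (odd a).
rewrite cycS /cyc lt0n => /negPf->; case: (odd a) => pw0.
  by exists (h1 w); rewrite homotopy1 -h0_proj pw0 raddf0 addr0.
by exists (h0 w); rewrite homotopy0 -homotopy2 -h1_proj pw0 raddf0 addr0.
Qed.

End CyclicHomotopy.

(** * Existence and uniqueness of the normal form x^a y^b z^c *)

Section NormalForm.
Local Open Scope group_scope.
Variables (q s1 s2 t1 t2 : nat).
Hypotheses (q_gt0 : 0 < q) (s1_gt0 : 0 < s1) (s2_gt0 : 0 < s2).
Hypotheses (t1s1 : t1 ^ s1 = 1 %[mod q]) (t2s2 : t2 ^ s2 = 1 %[mod q]).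

Local Notation T := ('I_s1 * 'I_s2 * 'I_q)%type.

(** Reduction of the exponents is built in, so equality of triples follows from congruences. *)
Let tri i j k : T :=
  (Ordinal (ltn_pmod i s1_gt0), Ordinal (ltn_pmod j s2_gt0),
   Ordinal (ltn_pmod k q_gt0)).

Let triP (u : T) : exists i j k,
  u = tri i j k /\ [/\ (i < s1)%N, (j < s2)%N & (k < q)%N].
Proof.
case: u => [[i j] k]; exists i, j, k; split=> //.
by congr (_, _, _); apply: val_inj; rewrite /= modn_small.
Qed.

Let tri_eq i j k i' j' k' :
  i = i' %[mod s1] -> j = j' %[mod s2] -> k = k' %[mod q] ->
  tri i j k = tri i' j' k'.
Proof. by move=> *; congr (_, _, _); apply: val_inj. Qed.

(* Right multiplication by x, y and z on the normal forms x^i y^j z^k. *)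
Let actX (u : T) := tri u.1.1.+1 u.1.2 (u.2 * t1).
Let actY (u : T) := tri u.1.1 u.1.2.+1 (u.2 * t2).
Let actZ (u : T) := tri u.1.1 u.1.2 u.2.+1.

Let actXE i j k : actX (tri i j k) = tri i.+1 j (k * t1).
Proof.
by apply: tri_eq; rewrite /= ?modn_mod ?modnMml // -addn1 modnDml addn1.
Qed.

Let actYE i j k : actY (tri i j k) = tri i j.+1 (k * t2).
Proof.
by apply: tri_eq; rewrite /= ?modn_mod ?modnMml // -addn1 modnDml addn1.
Qed.

Let actZE i j k : actZ (tri i j k) = tri i j k.+1.
Proof.
by apply: tri_eq; rewrite /= ?modn_mod ?modnMml // -addn1 modnDml addn1.
Qed.

Let iterX n i j k : iter n actX (tri i j k) = tri (i + n) j (k * t1 ^ n).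
Proof.
elim: n => [|n IH]; first by rewrite addn0 muln1.
by rewrite iterS IH actXE addnS expnSr mulnA.
Qed.

Let iterY n i j k : iter n actY (tri i j k) = tri i (j + n) (k * t2 ^ n).
Proof.
elim: n => [|n IH]; first by rewrite addn0 muln1.
by rewrite iterS IH actYE addnS expnSr mulnA.
Qed.

Let iterZ n i j k : iter n actZ (tri i j k) = tri i j (k + n).
Proof. by elim: n => [|n IH]; rewrite ?addn0 // iterS IH actZE addnS. Qed.

Let iter_actX u : iter s1 actX u = u.
Proof.
have [i [j [k [-> _]]]] := triP u; rewrite iterX.
by apply: tri_eq; rewrite ?modnDr // -modnMmr t1s1 modnMmr muln1.
Qed.

Let iter_actY u : iter s2 actY u = u.
Proof.
have [i [j [k [-> _]]]] := triP u; rewrite iterY.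
by apply: tri_eq; rewrite ?modnDr // -modnMmr t2s2 modnMmr muln1.
Qed.

Let iter_actZ u : iter q actZ u = u.
Proof.
have [i [j [k [-> _]]]] := triP u; rewrite iterZ.
by apply: tri_eq; rewrite ?modnDr.
Qed.

Let iter_inj n (act : T -> T) :
  0 < n -> (forall u, iter n act u = u) -> injective act.
Proof.
case: n => // n _ actK u v uv.
by rewrite -[u]actK -[v]actK !iterSr uv.
Qed.

Let permX := perm (iter_inj s1_gt0 iter_actX).
Let permY := perm (iter_inj s2_gt0 iter_actY).
Let permZ := perm (iter_inj q_gt0 iter_actZ).

Let perm_iter (act : T -> T) (act_inj : injective act) n u :
  (perm act_inj ^+ n) u = iter n act u.
Proof.
elim: n => [|n IH]; first by rewrite perm1.
by rewrite expgSr permM IH permE.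
Qed.

(** Permutations compose from left to right, as right multiplications do; zx = xz^t1 becomes (k + 1)
    t1 = k t1 + t1 on the exponents of z. *)
Let perm_relations : relations q s1 s2 t1 t2 permX permY permZ.
Proof.
split; split; apply/permP => u.
- by rewrite perm_iter perm1 iter_actX.
- by rewrite perm_iter perm1 iter_actY.
- by rewrite perm_iter perm1 iter_actZ.
- have [i [j [k [-> _]]]] := triP u.
  by rewrite !permM !permE actXE !actYE actXE mulnAC.
- have [i [j [k [-> _]]]] := triP u.
  by rewrite !permM perm_iter !permE actXE actZE actXE iterZ mulSn addnC.
- have [i [j [k [-> _]]]] := triP u.
  by rewrite !permM perm_iter !permE actYE actZE actYE iterZ mulSn addnC.
Qed.

Variables (G : groupType) (x y z : G).
Hypothesis G_presented : presented q s1 s2 t1 t2 x y z.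

(** The universal property maps G to permutations of exponent triples; the image of (0, 0, 0) under
    g defines the exponents of g. *)
Lemma normal_form : exists (al be ga : G -> nat),
  [/\ forall g, g = x ^+ al g * y ^+ be g * z ^+ ga g,
      forall g, [/\ (al g < s1)%N, (be g < s2)%N & (ga g < q)%N],
      forall g, al (g * x) = ((al g).+1 %% s1)%N,
      forall g, al (g * y) = al g /\ be (g * y) = ((be g).+1 %% s2)%N
    & forall g, [/\ al (g * z) = al g, be (g * z) = be g
                  & ga (g * z) = ((ga g).+1 %% q)%N]].
Proof.
case: G_presented => [[[xs ys zq] [xy zx zy]] gen_xyz univ].
have [f [fx fy fz]] := univ _ _ _ _ perm_relations.
have f1 : f 1 = 1 by apply: (mulgI (f 1)); rewrite -gmulfM !mulg1.
pose mon (u : T) := x ^+ u.1.1 * y ^+ u.1.2 * z ^+ u.2.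
have modX (w : G) n k : w ^+ n = 1 -> w ^+ (k %% n) = w ^+ k.
  move=> wn; rewrite [in RHS](divn_eq k n) expgnDr mulnC expgnA wn.
  by rewrite expg1n mul1g.
have monE i j k : mon (tri i j k) = x ^+ i * y ^+ j * z ^+ k.
  by rewrite /mon /= !modX.
have swap (v w : G) t k : v * w = w * v ^+ t -> v ^+ k * w = w * v ^+ (k * t).
  move=> vw; elim: k => [|k IH]; first by rewrite mul1g mulg1.
  by rewrite expgSr -mulgA vw mulgA IH -mulgA -expgnDr mulSn addnC.
(* By induction on the generation of g, [mon] turns the permutation [f g] into right multiplication
   by g; at (0, 0, 0) this factors g. *)
have monM g u : mon u * g = mon (f g u).
  move: g u; apply: gen_xyz.
  - move=> u; have [i [j [k [-> _]]]] := triP u.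
    rewrite fx permE actXE !monE -!mulgA (swap _ _ _ _ zx) expgSr -!mulgA.
    congr (_ * _); rewrite !mulgA; congr (_ * _).
    by apply: commute_sym; apply: commuteX.
  - move=> u; have [i [j [k [-> _]]]] := triP u.
    by rewrite fy permE actYE !monE -!mulgA (swap _ _ _ _ zy) expgSr -!mulgA.
  - move=> u; have [i [j [k [-> _]]]] := triP u.
    by rewrite fz permE actZE !monE -!mulgA expgSr.
  - by move=> u; rewrite mulg1 f1 perm1.
  - by move=> g h IHg IHh u; rewrite mulgA IHg IHh gmulfM permM.
  move=> g IHg u; apply: (mulIg g); rewrite mulgVK IHg.
  by rewrite -permM -gmulfM mulVg f1 perm1.
pose nf g := f g (tri 0 0 0).
have nfM g h : nf (g * h) = f h (nf g) by rewrite /nf gmulfM permM.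
exists (fun g => nat_of_ord (nf g).1.1), (fun g => nat_of_ord (nf g).1.2),
  (fun g => nat_of_ord (nf g).2).
split=> [g|g|g|g|g]; rewrite ?nfM ?fx ?fy ?fz ?permE //=.
- by have := monM g (tri 0 0 0); rewrite monE !mul1g.
- by split=> //; apply: modn_small.
by split=> //; apply: modn_small.
Qed.

End NormalForm.

(** * Exactness of the coefficient sequences in Z[G] *)

Section GroupRingExactness.
Local Open Scope ring_scope.
Variables (q s1 s2 t1 t2 : nat).
Hypotheses (q_gt0 : (0 < q)%N) (s1_gt0 : (0 < s1)%N) (s2_gt0 : (0 < s2)%N).
Hypotheses (t1s1 : t1 ^ s1 = 1 %[mod q]) (t2s2 : t2 ^ s2 = 1 %[mod q]).
Variables (G : groupType) (x y z : G).
Hypothesis G_presented : presented q s1 s2 t1 t2 x y z.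

Local Notation X := (gr_elt x).
Local Notation Y := (gr_elt y).
Local Notation Z := (gr_elt z).

(** The augmentation of Z[G]; [int^o] is int as a module over itself. *)
Definition aug : {additive 'Z[G] -> int} :=
  linext (fun _ : G => 1 : int^o) : {linear {malg int[G]} -> int^o}.

Lemma aug_elt g : aug (gr_elt g) = 1.
Proof. exact: (@linextU G int int^o (fun=> 1) g). Qed.

Lemma aug_mul_elt g w : aug (gr_elt g * w) = aug w.
Proof.
elim/group_ring_ind: w => [v w IHv IHw|h].
  by rewrite mulrBr !raddfB IHv IHw.
by rewrite -gr_eltM !aug_elt.
Qed.

Lemma aug_mul_subr1 g w : aug (w * (gr_elt g - 1)) = 0.
Proof.
elim/group_ring_ind: w => [v w IHv IHw|h].
  by rewrite mulrBl raddfB IHv IHw subr0.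
by rewrite mulrBr mulr1 -gr_eltM raddfB !aug_elt subrr.
Qed.

Lemma group_ring_exactness :
  [/\ forall w m, (0 < m)%N -> w * cyc Z q m = 0 ->
        exists w', w = w' * cyc Z q m.+1,
      forall v w b, (0 < b)%N -> v * (Z - 1) + w * cyc Y s2 b = 0 ->
        exists w1 w2, w = w1 * cyc Y s2 b.+1 + w2 * (Z - 1),
      forall v1 v2 w a, (0 < a)%N ->
        v1 * (Z - 1) + v2 * (Y - 1) + w * cyc X s1 a = 0 ->
        exists w1 w2 w3,
          w = w1 * cyc X s1 a.+1 + w2 * (Y - 1) + w3 * (Z - 1)
    & forall w, aug w = 0 -> exists w1 w2 w3,
          w = w1 * (X - 1) + w2 * (Y - 1) + w3 * (Z - 1)].
Proof.
have [al [be [ga [nfE nf_lt alX nfY nfZ]]]] :=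
  normal_form q_gt0 s1_gt0 s2_gt0 t1s1 t2s2 G_presented.
(* Normal forms with z removed, then y, then x: the homotopies apply to the pairs ([id], [p1]),
   ([p1], [p2]) and ([p2], [p3]). *)
pose p1 g := (x ^+ al g * y ^+ be g)%g; pose p2 g := (x ^+ al g)%g.
pose p3 (g : G) := 1%g : G.
have nfZX g k : al (g * z ^+ k)%g = al g /\ be (g * z ^+ k)%g = be g.
  elim: k => [|k [IHa IHb]]; first by rewrite mulg1.
  by rewrite expgSr mulgA; have [-> -> _] := nfZ (g * z ^+ k)%g.
have nfYX g k : al (g * y ^+ k)%g = al g.
  elim: k => [|k IH]; first by rewrite mulg1.
  by rewrite expgSr mulgA; have [->] := nfY (g * y ^+ k)%g.
have al1 g : al (p1 g) = al g by rewrite [in RHS](nfE g) (nfZX _ _).1.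
have be1 g : be (p1 g) = be g by rewrite [in RHS](nfE g) (nfZX _ _).2.
have al2 g : al (p2 g) = al g by rewrite -[RHS]al1 nfYX.
have p1Z g : p1 (g * z)%g = p1 g by rewrite /p1; have [-> -> _] := nfZ g.
have p2Y g : p2 (g * y)%g = p2 g by rewrite /p2; have [->] := nfY g.
pose P f := gr_lin (fun g : G => gr_elt (f g : G)).
have P_id w : P id w = w.
  elim/group_ring_ind: w => [v w IHv IHw|g]; first by rewrite raddfB IHv IHw.
  by rewrite gr_linE.
(* Cutting away the whole normal form leaves the augmentation times 1. *)
have P3 w : aug w = 0 -> P p3 w = 0.
  suff -> : P p3 w = (aug w)%:~R by move=> ->.
  elim/group_ring_ind: w => [v w IHv IHw|g].
    by rewrite !raddfB IHv IHw.
  by rewrite gr_linE aug_elt.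
have ltZ g : (ga g < q)%N by case: (nf_lt g).
have ltY g : (be g < s2)%N by case: (nf_lt g).
have ltX g : (al g < s1)%N by case: (nf_lt g).
have gaZ g : ga (g * z)%g = ((ga g).+1 %% q)%N by case: (nfZ g).
have beY g : be (g * y)%g = ((be g).+1 %% s2)%N by case: (nfY g).
have p21 g : p2 (p1 g) = p2 g by rewrite /p2 al1.
have p2X g : p2 g = (p3 g * x ^+ al g)%g by rewrite mul1g.
have P1K w : P p1 (w * (Z - 1)) = 0 by apply: proj_mul_subr1.
have P2K w : P p2 (w * (Y - 1)) = 0 by apply: proj_mul_subr1.
have P21 w : P p2 (P p1 w) = P p2 w by apply: proj_proj.
have decZ w : exists w', w = w' * (Z - 1) + P p1 w.
  have [w' wE] := proj_decomp (p := id) (p' := p1) nfE w.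
  by exists w'; rewrite -[LHS]P_id.
have decY w : exists w', P p1 w = w' * (Y - 1) + P p2 w.
  exact: (proj_decomp (p := p1) (p' := p2) (fun=> erefl)).
have decX w : exists w', P p2 w = w' * (X - 1) + P p3 w.
  exact: (proj_decomp p2X).
split.
- move=> w m m_gt0 w0.
  have [||w' wE] := proj_cyc_exact (p := id) (p' := p1) (e := ga)
    nfE ltZ p1Z gaZ _ _ m_gt0 (etrans (P_id _) w0) => //.
  by exists w'; rewrite -[LHS]P_id.
- move=> v w b b_gt0 vw0.
  have Pw0 : P p1 (w * cyc Y s2 b) = 0.
    by have := congr1 (P p1) vw0; rewrite raddfD P1K add0r raddf0.
  have [w1 Pw] := proj_cyc_exact (p := p1) (p' := p2) (e := be)
     (fun=> erefl) ltY p2Y beY p21 be1 b_gt0 Pw0.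
  by have [w2 wE] := decZ w; exists w1, w2; rewrite [LHS]wE Pw addrC.
- move=> v1 v2 w a a_gt0 vw0.
  have Pw0 : P p2 (w * cyc X s1 a) = 0.
    (* [P p2] factors through [P p1], so it kills the multiple of z - 1 as well. *)
    have := congr1 (P p2) vw0; rewrite !raddfD P2K addr0 -P21 P1K raddf0.
    by rewrite add0r.
  have [w1 Pw] := proj_cyc_exact (p := p2) (p' := p3) (e := al)
     p2X ltX (fun=> erefl) alX (fun=> erefl) al2 a_gt0 Pw0.
  have [w3 wE] := decZ w; have [w2 w1E] := decY w; exists w1, w2, w3.
  by rewrite [LHS]wE w1E Pw addrC (addrC (_ * (Y - 1))).
move=> w aug0; have [w3 wE] := decZ w; have [w2 w1E] := decY w.
have [w1 w2E] := decX w; exists w1, w2, w3.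
by rewrite [LHS]wE w1E w2E P3 // addr0 addrC (addrC (_ * (Y - 1))).
Qed.

End GroupRingExactness.

(** * Generators in quadrant coordinates *)

Section Cells.
Local Open Scope ring_scope.

(* The cell indexing a_{a+b,m,a}: in these coordinates the range 0 <= i <= n
   becomes the whole quadrant. *)
Definition cell_of (a b m : nat) : cell :=
  exist _ (a + b, m, a)%N (leq_addr b a).

Lemma cell_ofP (c : cell) : exists a b m, c = cell_of a b m.
Proof.
case: c => [[[n m] i] le_in]; exists i, (n - i)%N, m.
by apply: val_inj; rewrite /= subnKC.
Qed.

Lemma cell_of_eq a b m a' b' m' :
  (cell_of a b m == cell_of a' b' m') = [&& a == a', b == b' & m == m'].
Proof.
rewrite -val_eqE /= !xpair_eqE; apply/idP/idP.
  case/andP=> /andP[/eqP ab /eqP->] /eqP aa'; subst a'.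
  by rewrite !eqxx andbT /= -(eqn_add2l a) ab.
by case/and3P=> /eqP-> /eqP-> /eqP->; rewrite !eqxx.
Qed.

Variable G : groupType.

(* Opaque, because unification would otherwise unfold distinct basis elements
   when it compares them. *)
Fact basis_sig : {e : nat -> nat -> nat -> {malg 'Z[G][cell]} |
  forall a b m, e a b m = mkmalgU (cell_of a b m) 1}.
Proof. by exists (fun a b m => mkmalgU (cell_of a b m) 1). Qed.

Definition basis := sval basis_sig.

Lemma basisE a b m : basis a b m = mkmalgU (cell_of a b m) 1.
Proof. exact: (svalP basis_sig). Qed.

Lemma genE (n k i : int) (a b m : nat) :
  n = (a + b)%N -> k = m -> i = a -> gen G n k i = basis a b m.
Proof.
move=> -> -> ->; rewrite basisE /gen; case: insubP => /= [c _ cE|].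
  by congr (mkmalgU _ 1); apply: val_inj.
by rewrite leq_addr.
Qed.

Lemma gen_out (n k i : int) : (i < 0) || (n < i) -> gen G n k i = 0.
Proof.
rewrite /gen; case: n => n; case: k => k; case: i => i //= ni.
by case: insubP => //= c le_in; move: ni; rewrite ltz_nat ltnNge le_in.
Qed.

(** At a = 0 the left side has i = -1 while [a.-1] stays in range; the convention [cyc U s 0 = 0]
    reconciles them. *)
Lemma gen_predX (U : 'Z[G]) s (a b m : nat) C (n k i : int) :
    C = (if odd a then U - 1 else geom U s) ->
    n = (a + b)%N%:Z - 1 -> k = m -> i = a%:Z - 1 ->
  C *: gen G n k i = cyc U s a *: basis a.-1 b m.
Proof.
move=> -> -> -> ->; case: a => [|a].
  rewrite gen_out; last by lia.
  rewrite scaler0.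
 rewrite cyc0.
 by rewrite scale0r.
by rewrite (@genE _ _ _ a b m) //; lia.
Qed.

(** At b = 0 the generator is out of range because i = a exceeds n = a - 1. *)
Lemma gen_predY (V : 'Z[G]) s (a b m : nat) C (n k i : int) :
    C = (if odd b then V - 1 else geom V s) ->
    n = (a + b)%N%:Z - 1 -> k = m -> i = a ->
  C *: gen G n k i = cyc V s b *: basis a b.-1 m.
Proof.
move=> -> -> -> ->; case: b => [|b].
  by rewrite gen_out ?cyc0 ?scaler0 ?scale0r //; lia.
by rewrite (@genE _ _ _ a b m) //; lia.
Qed.

End Cells.

(** * The differential on basis elements *)

Section Differential.
Local Open Scope ring_scope.
Variables (q s1 s2 t1 t2 : nat) (G : groupType) (x y z : G).

Local Notation X := (gr_elt x).
Local Notation Y := (gr_elt y).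
Local Notation Z := (gr_elt z).
Local Notation d := (differential q s1 s2 t1 t2 x y z).
Local Notation dcoefZ := (dcoefZ q Z).
Local Notation dcoefX := (dcoefX s1 t1 X Z).
Local Notation dcoefY := (dcoefY s2 t2 Y Z).
Local Notation dcoefD := (dcoefD _ q).
Local Notation basis := (basis G).

Lemma d0_basis a b m : d0 q z (basis a b m) = dcoefZ m *: basis a b m.-1.
Proof.
transitivity (d0_gen q z (a + b) m a).
  by rewrite basisE; exact: linextU.
rewrite /d0_gen.
case: m => [|m]; first by rewrite /gen /dcoefZ cyc0 scaler0 scale0r.
by rewrite (@genE _ _ _ _ a b m) //; lia.
Qed.

Lemma d2_basis a b m : d2 q s1 s2 t1 t2 G (basis a b m) =
  dcoefD t1 s1 a m *: basis a.-2 b m.+1 + dcoefD t2 s2 b m *: basis a b.-2 m.+1.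
Proof.
transitivity (d2_gen q s1 s2 t1 t2 G (a + b) m a).
  by rewrite basisE; exact: linextU.
rewrite /d2_gen; have [odd_m|even_m] := boolP (odd m); last first.
  by rewrite !dcoefD_out ?scale0r ?addr0 // negb_and even_m.
rewrite addrC; congr (_ + _).
  have [lt1a|le_a1] := ltnP 1 a.
    by rewrite dcoefD_in // scaleNr (@genE _ _ _ _ a.-2 b m.+1) //; lia.
  rewrite dcoefD_out; last by rewrite negb_and -leqNgt le_a1 orbT.
  by rewrite gen_out ?scaler0 ?oppr0 ?scale0r //; lia.
have [lt1b|le_b1] := ltnP 1 b.
  by rewrite dcoefD_in // scaleNr (@genE _ _ _ _ a b.-2 m.+1) //; lia.
rewrite dcoefD_out; last by rewrite negb_and -leqNgt le_b1 orbT.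
by rewrite gen_out ?scaler0 ?oppr0 ?scale0r //; lia.
Qed.

Hypotheses (ZX : Z * X = X * Z ^+ t1) (ZY : Z * Y = Y * Z ^+ t2).

Lemma d1_basis a b m : d1 s1 s2 t1 t2 x y z (basis a b m) =
  dcoefX a m *: basis a.-1 b m + dcoefY a b m *: basis a b.-1 m.
Proof.
pose U := twist t1 X Z (uphalf m); pose V := twist t2 Y Z (uphalf m).
have fX (n k i : int) : n = (a + b)%N%:Z - 1 -> k = m -> i = a%:Z - 1 ->
    (if odd a then cX t1 x z (uphalf m) else sX s1 t1 x z (uphalf m))
      *: gen G n k i = cyc U s1 a *: basis a.-1 b m.
  by apply: gen_predX; case: (odd a); rewrite // sum_twist.
have fY (n k i : int) : n = (a + b)%N%:Z - 1 -> k = m -> i = a ->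
    (if odd b then cY t2 y z (uphalf m) else sY s2 t2 y z (uphalf m))
      *: gen G n k i = cyc V s2 b *: basis a b.-1 m.
  by apply: gen_predY; case: (odd b); rewrite // sum_twist.
have eX := scale_dcoefX s1 t1 X Z a m (basis a.-1 b m).
have eY := scale_dcoefY s2 t2 Y Z a b m (basis a b.-1 m).
transitivity (d1_gen s1 s2 t1 t2 x y z (a + b) m a).
  by rewrite basisE; exact: linextU.
rewrite /d1_gen; cbv zeta; move: eX eY fX fY; rewrite -/U -/V.
(* The rest is index arithmetic, so the coefficients become variables; the parities of a, b and m
   then select the eight clauses of [d1_gen], with n = a + b. *)
generalize (dcoefX a m) (dcoefY a b m) (cyc U s1 a) (cyc V s2 b).
generalize (cX t1 x z (uphalf m)) (sX s1 t1 x z (uphalf m)).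
generalize (cY t2 y z (uphalf m)) (sY s2 t2 y z (uphalf m)).
move=> C2 S2 C1 S1 CX CY KX KY.
move=> -> ->.
have oddE k : odd k -> (2 * Posz k./2 = k%:Z - 1) /\ (2 * Posz k./2 + 1 = k).
  by move=> ok; split; lia.
have evenE k :
    ~~ odd k -> (2 * Posz k./2 = k) /\ (2 * Posz k./2 - 1 = k%:Z - 1).
  by move=> ok; split; lia.
have oddm : odd m -> 2 * Posz (uphalf m) - 1 = m by lia.
have evenm : ~~ odd m -> 2 * Posz (uphalf m) = m by lia.
move: (oddE (a + b)%N) (evenE (a + b)%N) (oddE a) (evenE a) oddm evenm.
rewrite oddD; move: (uphalf m) => r.
case: (odd a); case: (odd b); case: (odd m).
all: cbv beta iota delta [addb negb] => oddk evenk oddl evenl oddm evenm.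
all: move=> fX fY; rewrite fX ?fY; try lia.
all: exact: addrC.
Qed.

Lemma d_basis a b m : d (basis a b m) =
  dcoefZ m *: basis a b m.-1
    + dcoefX a m *: basis a.-1 b m + dcoefY a b m *: basis a b.-1 m
    + dcoefD t1 s1 a m *: basis a.-2 b m.+1
    + dcoefD t2 s2 b m *: basis a b.-2 m.+1.
Proof.
by rewrite [LHS]/= d0_basis d1_basis d2_basis !addrA.
Qed.

End Differential.

(** * Leading-term argument for an abstract complex *)

(* The module V, its basis e and the coordinates are kept abstract: on the
   concrete module, unification unfolds the group ring operations. *)
Section TriangularComplex.
Local Open Scope ring_scope.
Variable R : nzRingType.
Variables (V : lmodType R) (e : nat -> nat -> nat -> V).
Variable coef : nat -> nat -> nat -> V -> R.
Implicit Types (c : V) (w : R).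

Hypothesis coefD : forall a b m c c',
  coef a b m (c + c') = coef a b m c + coef a b m c'.
Hypothesis coefZ : forall a b m w c, coef a b m (w *: c) = w * coef a b m c.
Hypothesis coef_e : forall a b m a' b' m',
  coef a' b' m' (e a b m) = ([&& a == a', b == b' & m == m'] : nat)%:R.
Hypothesis coef_eq0 : forall c, (forall a b m, coef a b m c = 0) -> c = 0.
Hypothesis chain_ind : forall P : V -> Prop,
    P 0 -> (forall c c', P c -> P c' -> P (c + c')) ->
    (forall w a b m, P (w *: e a b m)) ->
  forall c, P c.

Let coef0 a b m : coef a b m 0 = 0.
Proof. by rewrite -(scale0r 0) coefZ mul0r. Qed.

Let coefB a b m c c' : coef a b m (c - c') = coef a b m c - coef a b m c'.
Proof. by rewrite coefD -scaleN1r coefZ mulN1r. Qed.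

Definition homog k c :=
  forall a b m, (a + b + m)%N != k -> coef a b m c = 0.

Lemma homogB k c c' : homog k c -> homog k c' -> homog k (c - c').
Proof. by move=> h h' a b m abm; rewrite coefB h // h' // subrr. Qed.

Lemma homogD k c c' : homog k c -> homog k c' -> homog k (c + c').
Proof. by move=> h h' a b m abm; rewrite coefD h // h' // addr0. Qed.

Lemma homog_e k w a b m : (a + b + m = k)%N -> homog k (w *: e a b m).
Proof.
move=> abm a' b' m' abm'; rewrite coefZ coef_e.
case: and3P => [[/eqP aa /eqP bb /eqP mm]|_]; last by rewrite mulr0.
by case/eqP: abm'; rewrite -aa -bb -mm.
Qed.

(* The support of c consists of cells whose pair (n, i) is lexicographically
   smaller than the given one. *)
Definition below n i c := forall a b m,
  (n < a + b)%N || ((a + b == n)%N && (i <= a)%N) -> coef a b m c = 0.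

Lemma belowB n i c c' : below n i c -> below n i c' -> below n i (c - c').
Proof. by move=> h h' a b m ab; rewrite coefB h // h' // subrr. Qed.

Lemma belowD n i c c' : below n i c -> below n i c' -> below n i (c + c').
Proof. by move=> h h' a b m ab; rewrite coefD h // h' // addr0. Qed.

Lemma belowZ n i w c : below n i c -> below n i (w *: c).
Proof. by move=> h a b m ab; rewrite coefZ h // mulr0. Qed.

Lemma below_e n i w a b m :
  w = 0 \/ (a + b < n)%N || ((a + b == n)%N && (a < i)%N) ->
  below n i (w *: e a b m).
Proof.
case=> [->|ab] a' b' m' ab'; first by rewrite scale0r coef0.
rewrite coefZ coef_e; case: and3P => [[/eqP aa /eqP bb /eqP mm]|_].
  by subst; lia.
by rewrite mulr0.
Qed.

Variables (d : {linear V -> V}).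
Variables (cZ : nat -> R) (cX : nat -> nat -> R) (cY : nat -> nat -> nat -> R).
Variables (cF cG : nat -> nat -> R).
Hypothesis dE : forall a b m,
  d (e a b m) = cZ m *: e a b m.-1
    + cX a m *: e a.-1 b m + cY a b m *: e a b.-1 m
    + cF a m *: e a.-2 b m.+1 + cG b m *: e a b.-2 m.+1.
Hypotheses (cZ0 : cZ 0 = 0) (cX0 : forall m, cX 0 m = 0).
Hypotheses (cY0 : forall a m, cY a 0 m = 0).
Hypotheses (cF_small : forall a m, (a <= 1)%N -> cF a m = 0).
Hypotheses (cG_small : forall b m, (b <= 1)%N -> cG b m = 0).
Hypotheses (cF0 : forall a, cF a 0 = 0) (cG0 : forall b, cG b 0 = 0).

(** The coefficient at a cell collects its at most five sources, the two from d_2 only for m > 0.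
    Truncated predecessors add no spurious source, since the coefficients vanish at those small
    indices. *)
Lemma d_coef c a b m :
  coef a b m (d c) = coef a b m.+1 c * cZ m.+1
    + coef a.+1 b m c * cX a.+1 m + coef a b.+1 m c * cY a b.+1 m
    + (if m is m'.+1 then coef a.+2 b m' c * cF a.+2 m'
                        + coef a b.+2 m' c * cG b.+2 m'
       else 0).
Proof.
elim/chain_ind: c => [|c c' IH IH'|w a' b' m'].
- by rewrite linear0 !coef0; case: m => [|m]; rewrite ?coef0 !mul0r !addr0.
- rewrite linearD !coefD IH IH' !mulrDl.
  case: m {IH IH'} => [|m]; rewrite ?coefD ?mulrDl.
    by rewrite !addr0 (AC (3*3) ((1*4)*(2*5)*(3*6))).
  rewrite [LHS](AC (4*4) ((1*5)*(2*6)*(3*7)*(4*8))) /=; congr (_ + _).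
  by rewrite (AC (2*2) ((1*3)*(2*4))).
have scal (u : R) (t t' : bool) v : (t -> u = v) -> t = t' ->
    u * (t : nat)%:R = (t' : nat)%:R * v.
  by move=> uv <-; case: t uv => [->|_]; rewrite ?mulr1 ?mul1r ?mulr0 ?mul0r.
rewrite linearZ_LR !coefZ dE !coefD !coefZ !coef_e.
have tZ : cZ m' * ([&& a' == a, b' == b & m'.-1 == m] : nat)%:R
    = ([&& a' == a, b' == b & m' == m.+1] : nat)%:R * cZ m.+1.
  case: m' => [|m']; first by rewrite cZ0 mul0r !andbF mul0r.
  by apply: scal => // /and3P[_ _ /eqP<-].
have tX : cX a' m' * ([&& a'.-1 == a, b' == b & m' == m] : nat)%:R
    = ([&& a' == a.+1, b' == b & m' == m] : nat)%:R * cX a.+1 m.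
  case: a' {tZ} => [|a']; first by rewrite cX0 !mul0r.
  by apply: scal => // /and3P[/eqP<- _ /eqP<-].
have tY : cY a' b' m' * ([&& a' == a, b'.-1 == b & m' == m] : nat)%:R
    = ([&& a' == a, b' == b.+1 & m' == m] : nat)%:R * cY a b.+1 m.
  case: b' {tZ tX} => [|b']; first by rewrite cY0 mul0r andbF mul0r.
  by apply: scal => // /and3P[/eqP<- /eqP<- /eqP<-].
rewrite !mulrDr tZ tX tY -!mulrA -!addrA; do 3!congr (_ + _).
case: m {tZ tX tY} => [|m]; first by rewrite !andbF !mulr0 addr0.
rewrite !coefZ !coef_e -!mulrA -mulrDr -mulrDr; congr (w * (_ + _)).
  have [le_a1|lt1a] := leqP a' 1.
    by rewrite cF_small // mul0r; case: a' le_a1 => [|[|]] //; rewrite mul0r.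
  case: a' lt1a => [|[|a']] // _.
  by apply: scal => // /and3P[/eqP<- _ /eqP[<-]].
have [le_b1|lt1b] := leqP b' 1.
  rewrite cG_small // mul0r; case: b' le_b1 => [|[|]] //;
  by rewrite !andbF mul0r.
case: b' lt1b => [|[|b']] // _.
by apply: scal => // /and3P[_ /eqP<- /eqP[<-]].
Qed.

Lemma d_homog k c : homog k.+1 c -> homog k (d c).
Proof.
move=> ck a b m abm; rewrite d_coef !ck ?mul0r ?addr0; try lia.
by case: m abm => [|m] abm; rewrite ?ck ?mul0r ?addr0 //; lia.
Qed.

Lemma d_homog0 c : homog 0 c -> d c = 0.
Proof.
move=> c0; apply: coef_eq0 => a b m.
rewrite d_coef !c0 ?mul0r ?addr0; try lia.
by case: m => [|m]; rewrite ?c0 ?mul0r ?addr0 //; lia.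
Qed.

(** Only d_0 preserves n: the other terms have smaller n, or a zero coefficient where truncation
    would keep it. *)
Lemma d_leadZ a b m : below (a + b) a (d (e a b m.+1) - cZ m.+1 *: e a b m).
Proof.
rewrite dE (AC (5*1) ((1*6)*2*3*4*5)) /= subrr add0r.
do 3?apply: belowD; apply: below_e.
- by case: a => [|a]; [left|right; lia].
- by case: b => [|b]; [left|right; lia].
- by case: (leqP a 1) => [/cF_small->|]; [left|right; lia].
by case: (leqP b 1) => [/cG_small->|]; [left|right; lia].
Qed.

(** At m = 0 the x term has the same n as the y term but smaller i; here the second component of the
    order matters. *)
Lemma d_leadY a b :
  below (a + b) a (d (e a b.+1 0) - cY a b.+1 0 *: e a b 0).
Proof.
rewrite dE cZ0 cF0 cG0 !scale0r add0r !addr0 addrK.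
by apply: below_e; case: a => [|a]; [left|right; lia].
Qed.

Lemma d_leadX a : below (a + 0) a (d (e a.+1 0 0) - cX a.+1 0 *: e a 0 0).
Proof.
rewrite dE cZ0 cY0 cF0 cG0 !scale0r add0r !addr0 subrr.
by rewrite -(scale0r (e 0 0 0)); apply: below_e; left.
Qed.

Variable aug : {additive R -> int}.
Hypothesis augZ : forall w, aug (w * cZ 1) = 0.
Hypothesis augX : forall w, aug (w * cX 1 0) = 0.
Hypothesis augY : forall w, aug (w * cY 0 1 0) = 0.

Hypothesis exactZ : forall w m, w * cZ m.+1 = 0 -> exists w', w = w' * cZ m.+2.
Hypothesis exactY : forall v w a b,
  v * cZ 1 + w * cY a b.+1 0 = 0 ->
  exists w1 w2, w = w1 * cY a b.+2 0 + w2 * cZ 1.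
Hypothesis exactX : forall v1 v2 w a,
  v1 * cZ 1 + v2 * cY a 1 0 + w * cX a.+1 0 = 0 ->
  exists w1 w2 w3, w = w1 * cX a.+2 0 + w2 * cY a.+1 1 0 + w3 * cZ 1.
Hypothesis exact0 : forall w, aug w = 0 ->
  exists w1 w2 w3, w = w1 * cX 1 0 + w2 * cY 0 1 0 + w3 * cZ 1.

Lemma aug_d c : aug (coef 0 0 0 (d c)) = 0.
Proof. by rewrite d_coef addr0 !raddfD /= augZ augX augY. Qed.

Lemma lead_exact k c a b m : (a + b + m = k)%N ->
    homog k c -> below (a + b) a.+1 c -> d c = 0 -> aug (coef 0 0 0 c) = 0 ->
  exists2 c', homog k.+1 c' & below (a + b) a (d c' - coef a b m c *: e a b m).
Proof.
move=> abm ck cab dc0 augc.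
have dc a' b' m' :=
  etrans (esym (d_coef c a' b' m')) (etrans (congr1 _ dc0) (coef0 _ _ _)).
have lead w1 c1 w2 c2 w : below (a + b) a (d c1 - w1 *: e a b m) ->
    below (a + b) a (d c2 - w2 *: e a b m) ->
    below (a + b) a (d (w *: c1 + c2) - (w * w1 + w2) *: e a b m).
  move=> h1 h2; rewrite linearD linearZ_LR scalerDl opprD addrACA.
  rewrite -scalerA -scalerBr.
  by apply: belowD => //; apply: belowZ.
have lead1 w1 c1 w : below (a + b) a (d c1 - w1 *: e a b m) ->
    below (a + b) a (d (w *: c1) - (w * w1) *: e a b m).
  by move=> h1; rewrite linearZ_LR -scalerA -scalerBr; apply: belowZ.
case: m abm lead lead1 => [|m] abm lead lead1; last first.
  (* For m > 0, all sources other than the top cell have larger n, so they contribute 0. *)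
  have := dc a b m; rewrite [coef a.+1 b m c]cab ?mul0r ?addr0; last by lia.
  rewrite [coef a b.+1 m c]cab ?mul0r ?addr0; last by lia.
  have -> : (if m is m'.+1 then coef a.+2 b m' c * cF a.+2 m'
      + coef a b.+2 m' c * cG b.+2 m' else 0) = 0.
    by case: m {abm lead lead1} => // m; rewrite !cab ?mul0r ?addr0 //; lia.
  rewrite addr0 => /exactZ[w' ->]; exists (w' *: e a b m.+2).
    by apply: homog_e; lia.
  by apply: lead1; apply: d_leadZ.
case: b abm cab lead lead1 => [|b] abm cab lead lead1; last first.
  (* The x source has the same n and larger i, so it vanishes; the z source is unconstrained and
     makes the equation one modulo [cZ 1]. *)
  have := dc a b 0; rewrite addr0 [coef a.+1 b 0 c]cab; last by lia.
  rewrite mul0r addr0.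
  move=> /exactY[w1 [w2 ->]].
  exists (w1 *: e a b.+2 0 + w2 *: e a b.+1 1).
    by apply: homogD; apply: homog_e; lia.
  by apply: lead; [apply: d_leadY|apply/lead1/d_leadZ].
(* With b = m = 0 and a > 0 the equation holds modulo z and y multiples; for a = 0 the augmentation
   condition takes its place. *)
suff [w1 [w2 [w3 ->]]] : exists w1 w2 w3,
    coef a 0 0 c = w1 * cX a.+1 0 + w2 * cY a 1 0 + w3 * cZ 1.
  exists (w1 *: e a.+1 0 0 + (w2 *: e a 1 0 + w3 *: e a 0 1)).
    by apply: homogD; [|apply: homogD]; apply: homog_e; lia.
  rewrite -addrA; apply: (lead); first exact: d_leadX.
  by apply: lead; [apply: d_leadY|apply/lead1/d_leadZ].
case: a {abm cab lead lead1} => [|a]; first exact: exact0.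
apply: exactX (coef a 0 1 c) (coef a 1 0 c) _ _ _.
by have := dc a 0%N 0%N; rewrite addr0 -!addrA [X in _ + X]addrC.
Qed.

Hypothesis d_sqr : forall c, d (d c) = 0.

(** Lexicographic induction on (n, i): the degree k fixes m, so each step removes one coefficient by
    subtracting a boundary. *)
Lemma exact_below n i k c : homog k c -> below n i c ->
    d c = 0 -> aug (coef 0 0 0 c) = 0 ->
  exists2 c', homog k.+1 c' & d c' = c.
Proof.
pose P n i := forall c, homog k c -> below n i c -> d c = 0 ->
  aug (coef 0 0 0 c) = 0 -> exists2 c', homog k.+1 c' & d c' = c.
have step n' i' : P n' i' -> P n' i'.+1.
  move=> IH {}c ck cb dc0 augc.
  have [/andP[le_in le_nk]|out] :=
    boolP ((i' <= n') && (n' <= k))%N; last first.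
    (* No cell of degree k has this pair (n', i'), so there is nothing to remove. *)
    apply: IH => // a b m ab; have [E|/ck//] := eqVneq (a + b + m)%N k.
    by apply: cb; lia.
  pose b := (n' - i')%N; pose m := (k - n')%N.
  have nE : (i' + b)%N = n' by rewrite subnKC.
  have kE : (i' + b + m)%N = k by rewrite nE subnKC.
  have [|c1 ck1 lead] := lead_exact kE ck _ dc0 augc; first by rewrite nE.
  have dck1 : homog k (d c1) by apply: d_homog.
  have [c2 ck2 dc2] : exists2 c2, homog k.+1 c2 & d c2 = c - d c1.
    apply: IH; first exact: homogB.
    (* Both c and [d c1] have the same top term, which cancels in the difference. *)
    - have -> : c - d c1 = (c - coef i' b m c *: e i' b m)
          - (d c1 - coef i' b m c *: e i' b m) by rewrite opprB addrA subrK.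
      apply: belowB; last by rewrite nE in lead.
      move=> a0 b0 m0 ab0; rewrite coefB coefZ coef_e.
      have [/and3P[/eqP<- /eqP<- /eqP<-]|ne] := boolP [&& _, _ & _].
        by rewrite mulr1 subrr.
      rewrite mulr0 subr0; have [E|/ck//] := eqVneq (a0 + b0 + m0)%N k.
      by apply: cb; lia.
    - by rewrite linearB dc0 d_sqr subrr.
    by rewrite coefB raddfB augc aug_d subrr.
  exists (c2 + c1); first exact: homogD.
  by rewrite linearD dc2 subrK.
suff: P n i by apply.
elim: n i => [|n' IHn] i'; elim: i' => [|i' IHi]; do ?exact: step.
  (* Being below (0, 0) forces all coefficients to vanish. *)
  move=> {}c ck cb _ _; exists 0; first by move=> a b m _; apply: coef0.
  by rewrite linear0; apply/esym/coef_eq0 => a b m; apply: cb; lia.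
(* As i <= n on cells, being below (n' + 1, 0) is being below (n', n' + 1). *)
by move=> {}c ck cb; apply: (IHn n'.+1 c) => // a b m ab; apply: cb; lia.
Qed.

Lemma exact_homog k c : homog k c -> d c = 0 -> aug (coef 0 0 0 c) = 0 ->
  exists2 c', homog k.+1 c' & d c' = c.
Proof.
(* Cells of degree k have n <= k. *)
move=> ck; apply: (@exact_below k.+1 0) => // a b m ab; apply: ck; lia.
Qed.

Lemma triangular_complex :
  [/\ forall c, homog 0 c -> d c = 0,
      forall k c, homog k.+1 c -> homog k (d c),
      forall k c, homog k c -> d c = 0 -> aug (coef 0 0 0 c) = 0 ->
        exists2 c', homog k.+1 c' & d c' = c
    & forall c, aug (coef 0 0 0 (d c)) = 0].
Proof.
by split; [exact: d_homog0|exact: d_homog|exact: exact_homog|exact: aug_d].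
Qed.

End TriangularComplex.

(** * Acyclicity of the concrete complex *)

Section Acyclicity.
Local Open Scope ring_scope.
Variables (q s1 s2 t1 t2 : nat).
Hypotheses (q_gt0 : (0 < q)%N) (s1_gt0 : (0 < s1)%N) (s2_gt0 : (0 < s2)%N).
Hypotheses (t1_gt0 : (0 < t1)%N) (t2_gt0 : (0 < t2)%N).
Hypotheses (t1s1 : t1 ^ s1 = 1 %[mod q]) (t2s2 : t2 ^ s2 = 1 %[mod q]).
Variables (G : groupType) (x y z : G).
Hypothesis G_presented : presented q s1 s2 t1 t2 x y z.

Local Notation A := {malg 'Z[G][cell]}.
Local Notation X := (gr_elt x).
Local Notation Y := (gr_elt y).
Local Notation Z := (gr_elt z).
Local Notation d := (differential q s1 s2 t1 t2 x y z).
Local Notation coef a b m := (mcoeff (cell_of a b m)).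

Lemma coef_basis a b m a' b' m' :
  coef a' b' m' (basis G a b m) = ([&& a == a', b == b' & m == m'] : nat)%:R.
Proof. by rewrite basisE mcoeffU cell_of_eq. Qed.

Lemma coef_eq0 (c : A) : (forall a b m, coef a b m c = 0) -> c = 0.
Proof.
move=> c0; apply/malgP => u; have [a [b [m ->]]] := cell_ofP u.
by rewrite c0 [RHS]mcoeff0.
Qed.

Lemma basis_ind (P : A -> Prop) :
    P 0 -> (forall c c', P c -> P c' -> P (c + c')) ->
    (forall w a b m, P (w *: basis G a b m)) ->
  forall c, P c.
Proof.
move=> P0 PD Pb c; rewrite [c]monalgE; elim/big_ind: _ => // k _.
have [a [b [m ->]]] := cell_ofP k; move: (c@__) => w.
suff -> : mkmalgU (cell_of a b m) w = w *: basis G a b m by [].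
apply/malgP => k'; rewrite mcoeffZ basisE [LHS]mcoeffU [X in _ * X]mcoeffU.
by rewrite mulrnAr mulr1.
Qed.

Lemma in_degreeP k (c : A) :
  in_degree k c <-> homog (fun a b m => coef a b m) k c.
Proof.
split=> [ck a b m abm | ck u].
  by apply: mcoeff_outdom; apply: contraNN abm => /ck /= ->.
rewrite -mcoeff_neq0; have [a [b [m ->]]] := cell_ofP u.
by move=> cu; apply: contra_neq_eq cu => /ck.
Qed.

Lemma gr_relations :
  [/\ X ^+ s1 = 1, Y ^+ s2 = 1 & Z ^+ q = 1] /\
  [/\ X * Y = Y * X, Z * X = X * Z ^+ t1 & Z * Y = Y * Z ^+ t2].
Proof.
have [[[xs ys zq] [xy zx zy]] _ _] := G_presented.
by rewrite -!gr_eltX -!gr_eltM xs ys zq xy zx zy.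
Qed.

Lemma differential_basis a b m : d (basis G a b m) =
  dcoefZ q Z m *: basis G a b m.-1
    + dcoefX s1 t1 X Z a m *: basis G a.-1 b m
    + dcoefY s2 t2 Y Z a b m *: basis G a b.-1 m
    + dcoefD _ q t1 s1 a m *: basis G a.-2 b m.+1
    + dcoefD _ q t2 s2 b m *: basis G a b.-2 m.+1.
Proof. by have [_ [_ ZX ZY]] := gr_relations; apply: d_basis. Qed.

Lemma differential_sqr (c : A) : d (d c) = 0.
Proof.
have [[Xs Ys Zq] [XY ZX ZY]] := gr_relations.
(* The differential becomes a variable known only through its values on the basis. *)
move: differential_basis; generalize (differential q s1 s2 t1 t2 x y z) => f fE.
elim/basis_ind: c => [|c c' IH IH'|w a b m]; first by rewrite !linear0.
  by rewrite !linearD IH IH' addr0.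
rewrite !linearZ_LR.
have -> : f (f (basis G a b m)) = 0.
  exact: (d_basis_sqr q_gt0 s1_gt0 s2_gt0 t1_gt0 t2_gt0 t1s1 t2s2 Xs Ys Zq XY
    ZX ZY fE).
by rewrite scaler0.
Qed.

Lemma differential_acyclic : acyclic d.
Proof.
have [exZ exY exX ex0] :=
  group_ring_exactness q_gt0 s1_gt0 s2_gt0 t1s1 t2s2 G_presented.
move: d differential_basis differential_sqr => f fE f_sqr.
have coefD (a b m : nat) (c c' : A) :
    coef a b m (c + c') = coef a b m c + coef a b m c' by exact: mcoeffD.
have coefZ (a b m : nat) (w : 'Z[G]) (c : A) :
    coef a b m (w *: c) = w * coef a b m c by exact: mcoeffZ.
have augX w : aug G (w * dcoefX s1 t1 X Z 1 0) = 0.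
  by rewrite dcoefX0; apply: aug_mul_subr1.
have augY w : aug G (w * dcoefY s2 t2 Y Z 0 1 0) = 0.
  by rewrite dcoefY0 mul1r; apply: aug_mul_subr1.
have dcoefD0 t s a : dcoefD 'Z[G] q t s a 0 = 0 by exact: dcoefD_out.
have dcoefD_small t s a m : (a <= 1)%N -> dcoefD 'Z[G] q t s a m = 0.
  by move=> le_a1; rewrite dcoefD_out // negb_and -leqNgt le_a1 orbT.
have [f0 fS f_exact f_aug] :=
  @triangular_complex _ _ (basis G) (fun a b m => coef a b m) coefD coefZ
    coef_basis coef_eq0 basis_ind _ _ _ _ _ _ fE erefl (fun=> mulr0 _)
    (fun _ _ => mulr0 _) (dcoefD_small _ _) (dcoefD_small _ _) (dcoefD0 _ _)
    (dcoefD0 _ _) (aug G) (@aug_mul_subr1 G z) augX augY (dcoefZ_exact exZ)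
    (dcoefY_exact exY) (dcoefX_exact exX)
    (dcoef_exact0 q s1 s2 t1 t2 ex0) f_sqr.
split; first split.
- by move=> c /in_degreeP/f0.
- by move=> k c /in_degreeP/fS/in_degreeP.
- exact: f_sqr.
- move=> k c k_gt0 ck dc0; have hc := (in_degreeP k c).1 ck.
  have [|c' /in_degreeP ck' dc'] := f_exact k c hc dc0; last by exists c'.
  (* In positive degree the coefficient at [cell_of 0 0 0] is 0, so its augmentation vanishes. *)
  by rewrite hc ?raddf0 //; lia.
(* a_{0,0,0} is the only generator of degree 0. *)
pose eps : {additive A -> int} := aug G \o mcoeff (cell_of 0 0 0).
exists eps; split=> [g c|k|c /in_degreeP hc]; rewrite /eps.
- by rewrite /= coefZ aug_mul_elt.
- exists (k%:~R *: basis G 0 0 0).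
    by apply/in_degreeP; apply: (homog_e coefZ coef_basis).
  by rewrite /= coefZ coef_basis mulr1 raddfMz aug_elt intz.
split=> [augc|[c' _ <-]]; last exact: f_aug.
(* Chains of degree 0 are cycles, so exactness at k = 0 applies once the augmentation vanishes. *)
have [c' /in_degreeP hc' c'E] := f_exact 0 c hc (f0 c hc) augc.
by exists c'.
Qed.

End Acyclicity.

Theorem lemma3p3p1 (q s1 s2 t1 t2 : nat)
    (q_gt0 : (0 < q)%N) (s1_gt0 : (0 < s1)%N) (s2_gt0 : (0 < s2)%N)
    (t1_gt0 : (0 < t1)%N) (t2_gt0 : (0 < t2)%N)
    (t1s1 : t1 ^ s1 = 1 %[mod q]) (t2s2 : t2 ^ s2 = 1 %[mod q])
    (G : groupType) (x y z : G)
    (G_presented : presented q s1 s2 t1 t2 x y z) :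
  acyclic (differential q s1 s2 t1 t2 x y z).
Proof. exact: differential_acyclic G_presented. Qed.
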